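(* Let $p,Q$ be real-valued measurable functions on the finite interval $\mathcal J=(a,b)$ with $1/p,\ Q/p,\ Q^2/p\in L_1(\mathcal J)$, and for a contracting operator $K$ on $\mathbb C^2$ let $L_K$ be the maximal dissipative operator on $L_2(\mathcal J,\mathbb C)$ defined in the context. For any fixed $\lambda\in\mathbb C$ with $\operatorname{Im}\lambda<0$, the mapping $K\mapsto(L_K-\lambda)^{-1}$, defined on the set of contracting operators on $\mathbb C^2$, is a homeomorphism (onto its image, with the operator-norm topologies).
   Context: Let $\mathcal J=(a,b)$ be a finite interval and $L_2=L_2(\mathcal J,\mathbb C)$; $p$ is finite and nonzero a.e. The formal expression $-(py')'+qy$ with $q=Q'$ (distributional derivative) is interpreted through the quasi-derivatives $$D^{[0]}y=y,\qquad D^{[1]}y=py'-Qy,\qquad D^{[2]}y=(D^{[1]}y)'+\frac Qp D^{[1]}y+\frac{Q^2}{p}y$$ as $l[y]:=-D^{[2]}y$. The maximal operator is $L_{\max}y=l[y]$ with $\operatorname{Dom}(L_{\max})=\{y\in L_2:\ y,D^{[1]}y\in AC([a,b],\mathbb C),\ D^{[2]}y\in L_2\}$. Define $\Gamma_1,\Gamma_2:\operatorname{Dom}(L_{\max})\to\mathbb C^2$ by $$\Gamma_1y=(D^{[1]}y(a),-D^{[1]}y(b)),\qquad \Gamma_2y=(y(a),y(b)).$$ For a linear operator $K$ on $\mathbb C^2$, $L_K$ denotes the restriction of $L_{\max}$ to the set of $y\in\operatorname{Dom}(L_{\max})$ satisfying $$(K-I)\Gamma_1y+i(K+I)\Gamma_2y=0.$$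 A contracting operator is one with $\|K\|\le1$ (standard Hermitian norm on $\mathbb C^2$). When $K$ is contracting, $L_K$ is maximal dissipative, where an operator $L$ is dissipative if it is densely defined and $\operatorname{Im}(Lf,f)\ge0$ for all $f\in\operatorname{Dom}(L)$, and maximal dissipative if it has no nontrivial dissipative extensions. *)

(* Defs.v *)
From HB Require Import structures.
From mathcomp Require Import all_boot all_order all_algebra complex.
From mathcomp Require Import all_classical all_reals all_analysis.
From mathcomp Require Import measurable_realfun.
Set Implicit Arguments.
Unset Strict Implicit.
Unset Printing Implicit Defensive.
Import Order.TTheory GRing.Theory Num.Theory ComplexField.Normc.
Import numFieldNormedType.Exports.
Local Open Scope classical_set_scope.
Local Open Scope ring_scope.
Local Open Scope complex_scope.

(* Norms of R[i]-modules take values in the nonnegative reals of R[i]. *)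

Section ComplexNorm.
Context (R : realType).
Implicit Types x y : R[i].

Lemma le_Re x y : x <= y -> complex.Re x <= complex.Re y.
Proof. by rewrite lecE => /andP[]. Qed.

Lemma ge0_ReK x : 0 <= x -> (complex.Re x)%:C = x.
Proof. by case: x => [a b]; rewrite lecE /= => /andP[/eqP -> _]. Qed.

Lemma le_realC (a b : R) : (a%:C <= b%:C) = (a <= b).
Proof. by rewrite lecE /= eqxx. Qed.

Lemma norm_normc x : `|x| = (normc x)%:C.
Proof. by []. Qed.

Lemma normcD x y : normc (x + y) <= normc x + normc y.
Proof. by rewrite -le_realC rmorphD /= -!norm_normc ler_normD. Qed.

Lemma normc_ge0 x : 0 <= normc x.
Proof. by rewrite -le_realC -norm_normc normr_ge0. Qed.

End ComplexNorm.

(* B(V, W): continuous linear maps with the operator norm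
   ||f|| = sup {|f x| : |x| <= 1}.                                            *)
Section BoundedOperators.
Context (R : realType) (V W : normedModType R[i]).

Definition bounded_op_pred : {pred V -> W} :=
  mem [set f : V -> W | linear f /\ continuous f].

Record bounded_op := BoundedOp
  { bounded_op_fun :> V -> W; _ : bounded_op_fun \in bounded_op_pred }.

HB.instance Definition _ := [isSub for bounded_op_fun].
HB.instance Definition _ := [Choice of bounded_op by <:].

Lemma bounded_op_linear (f : bounded_op) : linear f.
Proof. by case: f => f /=; rewrite inE => -[]. Qed.

Lemma bounded_op_continuous (f : bounded_op) : continuous f.
Proof. by case: f => f /=; rewrite inE => -[]. Qed.

HB.instance Definition _ (f : bounded_op) :=
  GRing.isLinear.Build R[i] V W *:%R f (bounded_op_linear f).

Lemma bounded_op_submod_closed : submod_closed bounded_op_pred.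
Proof.
split.
  rewrite inE; split; first by move=> k u v; rewrite scaler0 addr0.
  exact: cst_continuous.
move=> k f g; rewrite !inE => -[lf cf] [lg cg]; split.
  move=> l u v; rewrite !fctE lf lg !scalerDr !scalerA (mulrC k).
  by rewrite addrACA.
by move=> x; apply: cvgD; [apply: cvgZl_tmp; exact: cf|exact: cg].
Qed.

HB.instance Definition _ := GRing.isSubmodClosed.Build _ _ bounded_op_pred
  bounded_op_submod_closed.
HB.instance Definition _ := [SubChoice_isSubLmodule of bounded_op by <:].

Lemma bounded_opD (f g : bounded_op) x : (f + g) x = f x + g x.
Proof. by []. Qed.

Lemma bounded_opZ k (f : bounded_op) x : (k *: f) x = k *: f x.
Proof. by []. Qed.

Definition op_norm_set (f : V -> W) : set R :=
  [set complex.Re `|f x| | x in [set x : V | `|x| <= 1]].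

Lemma op_norm_set_has_sup (f : bounded_op) : has_sup (op_norm_set f).
Proof.
split; first by exists (complex.Re `|f 0|), 0 => //=; rewrite normr0.
have /linear_bounded_continuous/linear_boundedP : continuous f.
  exact: bounded_op_continuous.
move=> /pinfty_ex_gt0[r r0 fr]; exists (complex.Re r) => _ [x /= x1 <-].
apply: le_Re; apply: (le_trans (fr x)).
by rewrite -[leRHS]mulr1 ler_wpM2l// ltW.
Qed.

Definition op_norm (f : bounded_op) : R[i] := (sup (op_norm_set f))%:C.

Lemma le_op_norm1 (f : bounded_op) x : `|x| <= 1 -> `|f x| <= op_norm f.
Proof.
move=> x1; rewrite -(ge0_ReK (normr_ge0 (f x))) le_realC.
by apply: ub_le_sup; [case: (op_norm_set_has_sup f)|exists x].
Qed.

Lemma op_norm_le (f : bounded_op) (M : R[i]) :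
  (forall x, `|x| <= 1 -> `|f x| <= M) -> op_norm f <= M.
Proof.
move=> fM; have M0 : 0 <= M by rewrite (le_trans _ (fM 0 _))// normr0.
rewrite -(ge0_ReK M0) le_realC; apply: ge_sup.
  by case: (op_norm_set_has_sup f).
by move=> _ [x /= x1 <-]; exact/le_Re/fM.
Qed.

Lemma op_norm_ge0 (f : bounded_op) : 0 <= op_norm f.
Proof. by rewrite (le_trans _ (le_op_norm1 f (x := 0) _))// normr0. Qed.

Lemma le_op_norm (f : bounded_op) x : `|f x| <= op_norm f * `|x|.
Proof.
have [->|x0] := eqVneq x 0; first by rewrite linear0 !normr0 mulr0.
have nx0 : 0 < `|x| by rewrite normr_gt0.
have := @le_op_norm1 f (`|x|^-1 *: x).
rewrite normrZ normfV normr_id mulVf ?gt_eqF// lexx => /(_ isT).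
by rewrite linearZ/= normrZ normfV normr_id ler_pdivrMl// mulrC.
Qed.

Lemma op_normD f g : op_norm (f + g) <= op_norm f + op_norm g.
Proof.
apply: op_norm_le => x x1; rewrite bounded_opD.
by rewrite (le_trans (ler_normD _ _))// lerD// le_op_norm1.
Qed.

Lemma op_normZ k f : op_norm (k *: f) = `|k| * op_norm f.
Proof.
have le1 l g : op_norm (l *: g) <= `|l| * op_norm g.
  apply: op_norm_le => x x1.
  by rewrite bounded_opZ normrZ ler_wpM2l// le_op_norm1.
apply/eqP; rewrite eq_le le1/=.
have [->|k0] := eqVneq k 0; first by rewrite normr0 mul0r op_norm_ge0.
rewrite -ler_pdivlMl ?normr_gt0// -normfV.
by rewrite -{1}[f](scalerK k0) le1.
Qed.

Lemma op_norm_eq0 f : op_norm f = 0 -> f = 0.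
Proof.
move=> f0; apply/val_inj/funext => x /=.
have := le_op_norm f x.
by rewrite f0 mul0r normr_le0 => /eqP.
Qed.

HB.instance Definition _ := Lmodule_isNormed.Build R[i] bounded_op
  op_normD op_normZ op_norm_eq0.
End BoundedOperators.

Section HermitianC2.
Context (R : realType).

(* An alias of 'cV[R[i]]_2 sharing only its module structure: the normed
   structure of 'cV in MathComp-Analysis is the sup norm.                     *)
Definition hermC2 : Type := 'cV[R[i]]_2.
HB.instance Definition _ := GRing.Lmodule.on hermC2.

Definition herm_norm (v : hermC2) : R[i] :=
  (Num.sqrt (\sum_(i < 2) normc (v i 0) ^+ 2))%:C.

Lemma herm_normD u v : herm_norm (u + v) <= herm_norm u + herm_norm v.
Proof.
rewrite /herm_norm -rmorphD le_realC !big_ord_recl !big_ord0 !addr0 !mxE.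
set a := normc (u _ _); set b := normc (u _ _).
set c := normc (v _ _); set d := normc (v _ _).
have a0 : 0 <= a := normc_ge0 _.
have b0 : 0 <= b := normc_ge0 _.
have c0 : 0 <= c := normc_ge0 _.
have d0 : 0 <= d := normc_ge0 _.
apply: (@le_trans _ _ (Num.sqrt ((a + c) ^+ 2 + (b + d) ^+ 2))).
  rewrite ler_wsqrtr// lerD// lerXn2r ?nnegrE ?normc_ge0 ?addr_ge0//.
    exact: normcD.
  exact: normcD.
have := ler_normD (a +i* b) (c +i* d).
by rewrite !norm_normc -rmorphD le_realC.
Qed.

Lemma herm_normZ k v : herm_norm (k *: v) = `|k| * herm_norm v.
Proof.
rewrite /herm_norm norm_normc -rmorphM; congr (_%:C).
under eq_bigr do rewrite mxE normcM exprMn.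
by rewrite -mulr_sumr sqrtrM ?sqr_ge0// sqrtr_sqr ger0_norm// normc_ge0.
Qed.

Lemma herm_norm_eq0 v : herm_norm v = 0 -> v = 0.
Proof.
move=> [] /eqP; rewrite sqrtr_eq0 => s0.
have /eqP : \sum_(i < 2) normc (v i 0) ^+ 2 = 0.
  by apply/eqP; rewrite eq_le s0/= sumr_ge0// => i _; rewrite sqr_ge0.
rewrite psumr_eq0; last by move=> i _; rewrite sqr_ge0.
move=> /allP v0; apply/colP => i; rewrite mxE; apply: eq0_normc.
by apply/eqP; rewrite -sqrf_eq0; apply: (v0 i); rewrite mem_index_enum.
Qed.

HB.instance Definition _ := Lmodule_isNormed.Build R[i] hermC2
  herm_normD herm_normZ herm_norm_eq0.
End HermitianC2.

(* L_2(mu, C): square-integrable functions modulo equality mu-almost everywhere,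
   with the norm (\int |f|^2)^(1/2).  A class u coerces to a representative. *)
Section ComplexL2.
Context d (T : measurableType d) (R : realType).

Definition cmeasurable (f : T -> R[i]) :=
  measurable_fun setT (fun x => complex.Re (f x)) /\
  measurable_fun setT (fun x => complex.Im (f x)).

Lemma measurable_normc f : cmeasurable f ->
  measurable_fun setT (fun x => normc (f x)).
Proof.
move=> [mr mi].
have -> : (fun x => normc (f x)) = (@Num.sqrt R) \o
    (fun x => complex.Re (f x) ^+ 2 + complex.Im (f x) ^+ 2).
  by apply/funext => x /=; case: (f x).
apply: measurableT_comp.
  by apply: continuous_measurable_fun; exact: sqrt_continuous.
by apply: measurable_funD; exact: measurable_funX.
Qed.

Lemma cmeasurableD f g : cmeasurable f -> cmeasurable g ->
  cmeasurable (f + g).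
Proof.
move=> [fr fi] [gr gi]; split.
  rewrite (_ : (fun x => _) = (fun x => complex.Re (f x) + complex.Re (g x))).
    exact: measurable_funD.
  by apply/funext => x; rewrite fctE; case: (f x) (g x) => [? ?] [? ?].
rewrite (_ : (fun x => _) = (fun x => complex.Im (f x) + complex.Im (g x))).
  exact: measurable_funD.
by apply/funext => x; rewrite fctE; case: (f x) (g x) => [? ?] [? ?].
Qed.

Lemma cmeasurableZ (k : R[i]) f : cmeasurable f -> cmeasurable (k *: f).
Proof.
case: k => [a b] [fr fi]; split.
  rewrite (_ : (fun x => _) =
      (fun x => a * complex.Re (f x) - b * complex.Im (f x))).
    by apply: measurable_funB; exact: measurable_funM.
  by apply/funext => x; rewrite fctE; case: (f x) => [? ?].
rewrite (_ : (fun x => _) =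
    (fun x => a * complex.Im (f x) + b * complex.Re (f x))).
  by apply: measurable_funD; exact: measurable_funM.
by apply/funext => x; rewrite fctE; case: (f x) => [? ?].
Qed.

Variable mu : {measure set T -> \bar R}.

Definition eL2norm (f : T -> R[i]) : \bar R :=
  Lnorm mu 2%:E (fun x => (normc (f x))%:E).

Lemma eL2norm0 : eL2norm 0 = 0%E.
Proof.
rewrite /eL2norm (_ : (fun x => _) = cst 0%E) ?Lnorm0//.
by apply/funext => x; rewrite normc0.
Qed.

Lemma eL2normE f : eL2norm f = ((\int[mu]_x (normc (f x) ^+ 2)%:E) `^ 2^-1)%E.
Proof.
rewrite /eL2norm unlock; congr (_ `^ _)%E; apply: eq_integral => x _ /=.
by rewrite ger0_norm ?normc_ge0// powR_mulrn// normc_ge0.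
Qed.

Lemma eL2normD f g : cmeasurable f -> cmeasurable g ->
  (eL2norm (f + g)%R <= eL2norm f + eL2norm g)%E.
Proof.
move=> mf mg; have mfn := measurable_normc mf; have mgn := measurable_normc mg.
apply: le_trans (minkowski_EFin mu mfn mgn _); last by rewrite ler1n.
rewrite /eL2norm unlock /=; apply: gt0_ler_poweR => //.
- by rewrite in_itv/= leey integral_ge0// => x _; exact: poweR_ge0.
- by rewrite in_itv/= leey integral_ge0// => x _; exact: poweR_ge0.
have mpow (h : T -> R) : measurable_fun setT h ->
    measurable_fun setT (fun x : T => (`|h x| `^ 2)%:E).
  move=> mh; apply/measurable_EFinP.
  rewrite (_ : (fun x => _) = (@powR R ^~ 2) \o (fun x => `|h x|)).
    by apply: measurableT_comp; [exact: measurable_powR|exact: measurableT_comp].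
  by [].
apply: ge0_le_integral => //.
- exact/mpow/measurable_normc/cmeasurableD.
- by apply: mpow; exact: measurable_funD.
move=> x _ /=; rewrite lee_fin ge0_ler_powR ?nnegrE ?normr_ge0//.
rewrite !ger0_norm ?addr_ge0 ?normc_ge0//.
exact: normcD.
Qed.

Lemma eL2normZ k f : cmeasurable f ->
  eL2norm (k *: f) = ((normc k)%:E * eL2norm f)%E.
Proof.
move=> mf; rewrite !eL2normE.
under eq_integral do rewrite fctE normcM exprMn EFinM.
rewrite ge0_integralZl//; last 3 first.
- apply: measurableT_comp => //; apply: measurable_funX.
  exact: measurable_normc.
- by move=> x _; rewrite lee_fin sqr_ge0.
- by rewrite lee_fin sqr_ge0.
rewrite poweRM ?lee_fin ?sqr_ge0//; last first.
  by apply: integral_ge0 => x _; rewrite lee_fin sqr_ge0.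
by rewrite poweR_EFin powR12_sqrt ?sqr_ge0// sqrtr_sqr ger0_norm// normc_ge0.
Qed.

Lemma ae_eq_eL2norm f g : cmeasurable f -> cmeasurable g ->
  {ae mu, forall x, f x = g x} -> eL2norm f = eL2norm g.
Proof.
move=> mf mg fg; rewrite !eL2normE; congr (_ `^ _)%E.
apply: ge0_ae_eq_integral => //.
- apply: measurableT_comp => //; apply: measurable_funX.
  exact: measurable_normc.
- apply: measurableT_comp => //; apply: measurable_funX.
  exact: measurable_normc.
- by move=> x _; rewrite lee_fin sqr_ge0.
- by move=> x _; rewrite lee_fin sqr_ge0.
by apply: filterS fg => x ->.
Qed.

Lemma eL2norm_eq0 f : cmeasurable f -> eL2norm f = 0%E ->
  {ae mu, forall x, f x = 0}.
Proof.
move=> mf f0.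
have mnf : measurable_fun setT (fun x => (normc (f x))%:E).
  by apply/measurable_EFinP; exact: measurable_normc.
have := Lnorm_eq0_eq0 mnf _ f0; rewrite lte_fin ltr0n => /(_ isT).
by apply: filterS => x /= /(_ Logic.I)[]; exact: eq0_normc.
Qed.

Definition sqint : {pred T -> R[i]} :=
  mem [set f | cmeasurable f /\ (eL2norm f < +oo)%E].

Lemma sqint_submod_closed : submod_closed sqint.
Proof.
split.
  by rewrite inE; split; [split; exact: measurable_cst|rewrite eL2norm0].
move=> k f g; rewrite !inE => -[mf fo] [mg go].
have mkf := cmeasurableZ k mf.
split; first exact: cmeasurableD.
apply: le_lt_trans (eL2normD mkf mg) _.
by rewrite lte_add_pinfty// eL2normZ// lte_mul_pinfty// lee_fin normc_ge0.
Qed.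

HB.instance Definition _ := GRing.isSubmodClosed.Build _ _ sqint
  sqint_submod_closed.

Record sqfun := SqFun { sqfun_fun :> T -> R[i]; _ : sqfun_fun \in sqint }.
HB.instance Definition _ := [isSub for sqfun_fun].
HB.instance Definition _ := [Choice of sqfun by <:].
HB.instance Definition _ := [SubChoice_isSubLmodule of sqfun by <:].

Lemma sqfun_measurable (f : sqfun) : cmeasurable f.
Proof. by case: f => f /=; rewrite inE => -[]. Qed.

Lemma sqfun_finite (f : sqfun) : (eL2norm f < +oo)%E.
Proof. by case: f => f /=; rewrite inE => -[]. Qed.

Lemma sqfun_fin_num (f : sqfun) : eL2norm f \is a fin_num.
Proof. by rewrite ge0_fin_numE ?Lnorm_ge0// sqfun_finite. Qed.

Definition ae_null : {pred sqfun} :=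
  mem [set f : sqfun | {ae mu, forall x, f x = 0}].

Lemma ae_null_submod_closed : submod_closed ae_null.
Proof.
split; first by rewrite inE; exact/nearW.
move=> k f g; rewrite !inE/=; apply: filterS2 => x fx gx.
rewrite [LHS](_ : _ = k *: f x + g x)// fx gx.
by rewrite scaler0 addr0.
Qed.

HB.instance Definition _ := GRing.isSubmodClosed.Build _ _ ae_null
  ae_null_submod_closed.

Definition cL2 : Type := Quotient.quot ae_null.
HB.instance Definition _ := GRing.Zmodule.on cL2.
HB.instance Definition _ := EqQuotient.on cL2.

Local Open Scope quotient_scope.

Definition cL2_fun (u : cL2) : T -> R[i] := (repr u : sqfun).

Lemma cL2_funP u : cL2_fun u \in sqint.
Proof. by rewrite /cL2_fun; case: (repr u). Qed.

Lemma pi_cL2P (f g : sqfun) :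
  \pi_cL2 f = \pi_cL2 g <-> {ae mu, forall x, f x = g x}.
Proof.
have -> : (\pi_cL2 f = \pi_cL2 g) <-> (f - g) \in ae_null.
  by rewrite Quotient.idealrBE; split => [/eqP|/eqP].
rewrite inE/=; split; apply: filterS => x.
  by change (f x - g x = 0 -> f x = g x) => /eqP; rewrite subr_eq0 => /eqP.
by move=> fgx; change (f x - g x = 0); rewrite fgx subrr.
Qed.

Lemma repr_cL2K (f : sqfun) :
  {ae mu, forall x, cL2_fun (\pi_cL2 f) x = f x}.
Proof. by apply/pi_cL2P; rewrite reprK. Qed.

Lemma pi_cL2D (f g : sqfun) : \pi_cL2 (f + g) = \pi_cL2 f + \pi_cL2 g.
Proof. exact: Quotient.pi_add. Qed.

Definition cL2_scale (k : R[i]) (u : cL2) : cL2 := \pi_cL2 (k *: repr u).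

Lemma pi_cL2Z k (f : sqfun) : \pi_cL2 (k *: f) = cL2_scale k (\pi_cL2 f).
Proof.
apply/pi_cL2P; apply: filterS (repr_cL2K f) => x; rewrite /cL2_fun => fx.
rewrite [LHS](_ : _ = k *: f x)// [RHS](_ : _ = k *: repr (\pi_cL2 f) x)//.
by rewrite fx.
Qed.

Lemma cL2_scaleA a b u : cL2_scale a (cL2_scale b u) = cL2_scale (a * b) u.
Proof. by rewrite -[cL2_scale b u]/(\pi_cL2 _) -pi_cL2Z scalerA. Qed.

Lemma cL2_scale1 : left_id 1 cL2_scale.
Proof. by move=> u; rewrite /cL2_scale scale1r reprK. Qed.

Lemma cL2_scaleDr : right_distributive cL2_scale +%R.
Proof.
move=> k u v; rewrite -[u]reprK -[v]reprK -pi_cL2D -!pi_cL2Z -pi_cL2D.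
by rewrite scalerDr.
Qed.

Lemma cL2_scaleDl u : {morph cL2_scale^~ u : a b / a + b}.
Proof. by move=> a b; rewrite /cL2_scale scalerDl pi_cL2D. Qed.

HB.instance Definition _ := GRing.Zmodule_isLmodule.Build R[i] cL2
  cL2_scaleA cL2_scale1 cL2_scaleDr cL2_scaleDl.

Lemma cL2_funD (u v : cL2) :
  {ae mu, forall x, cL2_fun (u + v) x = cL2_fun u x + cL2_fun v x}.
Proof.
have := repr_cL2K (repr u + repr v).
by rewrite pi_cL2D !reprK; apply: filterS => x ->.
Qed.

Lemma cL2_funZ k (u : cL2) :
  {ae mu, forall x, cL2_fun (k *: u) x = k *: cL2_fun u x}.
Proof. by apply: filterS (repr_cL2K (k *: repr u)) => x ->. Qed.

Definition cL2_norm (u : cL2) : R[i] := (fine (eL2norm (cL2_fun u)))%:C.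

Let cmf (u : cL2) : cmeasurable (cL2_fun u) := sqfun_measurable (repr u).

Lemma cL2_normD u v : cL2_norm (u + v) <= cL2_norm u + cL2_norm v.
Proof.
rewrite /cL2_norm -rmorphD le_realC -fineD; try exact: sqfun_fin_num.
rewrite fine_le//; first exact: sqfun_fin_num.
  by rewrite fin_numD !sqfun_fin_num.
rewrite (@ae_eq_eL2norm _ (cL2_fun u + cL2_fun v)) //.
- exact: eL2normD.
- exact: cmeasurableD.
exact: cL2_funD.
Qed.

Lemma cL2_normZ k u : cL2_norm (k *: u) = `|k| * cL2_norm u.
Proof.
rewrite /cL2_norm norm_normc -rmorphM; congr (_%:C).
rewrite (@ae_eq_eL2norm _ (k *: cL2_fun u))//.
- by rewrite eL2normZ// fineM//; exact: sqfun_fin_num.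
- exact: cmeasurableZ.
exact: cL2_funZ.
Qed.

Lemma cL2_norm_eq0 u : cL2_norm u = 0 -> u = 0.
Proof.
move=> [] u0; rewrite -[u]reprK -[0]reprK; apply/pi_cL2P.
have /(eL2norm_eq0 (cmf u)) : eL2norm (cL2_fun u) = 0%E.
  by rewrite -(fineK (sqfun_fin_num (repr u))); congr (_%:E).
have := repr_cL2K 0; rewrite (_ : \pi_cL2 0 = 0); last first.
  by apply: (addrI (\pi_cL2 0)); rewrite -pi_cL2D !addr0.
by apply: filterS2 => x zx ux; rewrite -/(cL2_fun _) ux -/(cL2_fun 0) zx.
Qed.

HB.instance Definition _ := Lmodule_isNormed.Build R[i] cL2
  cL2_normD cL2_normZ cL2_norm_eq0.

End ComplexL2.
Arguments cL2 {d T R} mu.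
Coercion cL2_fun : cL2 >-> Funclass.

Section HomeoOntoImage.
Context {X Y : topologicalType}.

(* f restricted to A is a homeomorphism from A onto f @` A, both sets carrying
   the subspace topology.                                                     *)
Definition homeo_onto_image (A : set X) (f : X -> Y) : Prop :=
  {within A, continuous f} /\
  exists g : Y -> X, {in A, cancel f g} /\ {within f @` A, continuous g}.

End HomeoOntoImage.

Section Resolvent.
Context (R : realType) (V : normedModType R[i]).

(* An unbounded operator A is given by its graph: [A u v] means u \in Dom(A)
   and A u = v.                                                               *)
Definition is_resolvent (A : V -> V -> Prop) (lam : R[i])
    (T : bounded_op V V) : Prop :=
  forall f u, T f = u <-> exists2 v, A u v & v - lam *: u = f.

Definition resolvent_set (A : V -> V -> Prop) : set R[i] :=
  [set lam | exists T, is_resolvent A lam T].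

(* (A - lam)^-1; the value 0 off the resolvent set is a junk value. *)
Definition resolvent (A : V -> V -> Prop) (lam : R[i]) : bounded_op V V :=
  xget 0 [set T | is_resolvent A lam T].

End Resolvent.

(* Classes are represented by Borel functions on R, restricted to ]a, b[ by the
   measure; every Lebesgue class on ]a, b[ has such a representative.         *)
Notation L2J a b := (cL2 (mrestr lebesgue_measure (measurable_itv `]a, b[))).

Section SturmLiouville.
Context (R : realType).

(* R with the sigma-algebra of Lebesgue measurable sets. *)
Definition lebesgueT : Type := caratheodory_type (R := R) ((wlength idfun)^*)%mu.
HB.instance Definition _ := Measurable.on lebesgueT.

Definition lebesgue_measurable_fun (D : set R) (f : R -> R) : Prop :=
  measurable_fun (D : set lebesgueT) (f : lebesgueT -> R).

Definition lebesgue_L1 (D : set R) (f : R -> R) : Prop :=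
  completed_lebesgue_measure.-integrable D (EFin \o f).

Definition ae_on (a b : R) (P : R -> Prop) : Prop :=
  {ae lebesgue_measure, forall x : R, a < x < b -> P x}.

(* f is absolutely continuous on [a, b]. *)
Definition abs_cont (a b : R) (f : R -> R[i]) : Prop :=
  forall e : R, 0 < e -> exists2 d : R, 0 < d &
    forall (n : nat) (s t : 'I_n -> R),
      (forall i, [/\ a <= s i, s i <= t i & t i <= b]) ->
      trivIset [set: 'I_n] (fun i => `]s i, t i[%classic) ->
      \sum_(i < n) (t i - s i) < d ->
      \sum_(i < n) normc (f (t i) - f (s i)) < e.

Definition cderivable (f : R -> R[i]) (x : R) : Prop :=
  derivable (fun t => complex.Re (f t)) x 1 /\
  derivable (fun t => complex.Im (f t)) x 1.

Definition cderiv (f : R -> R[i]) (x : R) : R[i] :=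
  derive1 (fun t => complex.Re (f t)) x +i*
  derive1 (fun t => complex.Im (f t)) x.

Variables (p Q : R -> R) (a b : R).

Definition qderiv1 (y : R -> R[i]) (x : R) : R[i] :=
  (p x)%:C * cderiv y x - (Q x)%:C * y x.

(* D^[2] y, where z is D^[1] y. *)
Definition qderiv2 (y z : R -> R[i]) (x : R) : R[i] :=
  cderiv z x + (Q x / p x)%:C * z x + (Q x ^+ 2 / p x)%:C * y x.

(* The class u belongs to Dom(L_max) and L_max u = v.  D^[1] y is only defined
   almost everywhere; y and z are the absolutely continuous representatives of
   u and of D^[1] u, whose values at a and b enter the boundary conditions.   *)
Definition Lmax_data (y z : R -> R[i]) (u v : L2J a b) : Prop :=
  [/\ abs_cont a b y, abs_cont a b z,
      ae_on a b (fun x => cderivable y x /\ z x = qderiv1 y x),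
      ae_on a b (fun x => u x = y x)
    & ae_on a b (fun x => cderivable z x /\ v x = - qderiv2 y z x)].

Definition Gamma1 (z : R -> R[i]) : hermC2 R :=
  \col_(i < 2) (if i == 0 then z a else - z b).

Definition Gamma2 (y : R -> R[i]) : hermC2 R :=
  \col_(i < 2) (if i == 0 then y a else y b).

Definition LK (K : bounded_op (hermC2 R) (hermC2 R)) (u v : L2J a b) : Prop :=
  exists y z, Lmax_data y z u v /\
    K (Gamma1 z) - Gamma1 z +
    (0 +i* 1) *: (K (Gamma2 y) + Gamma2 y) = 0.

End SturmLiouville.
Arguments LK {R} p Q a b K u v.

Definition contracting (R : realType)
    (K : bounded_op (hermC2 R) (hermC2 R)) : Prop := `|K| <= 1.

(* Main.v *)
(* Put G+ = Gamma_1 y + i Gamma_2 y and G- = Gamma_1 y - i Gamma_2 y, so that the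
   boundary condition of L_K reads K G+ = G-.  For (l - lam) y = f with
   m = - Im lam > 0, Green's formula gives
     |G+|^2 + 2 m |y|^2 <= |G-|^2 + (2/m) |f|^2,
   so for a contraction K a solution is unique and |y| <= |f|/m.  A solution with
   given f and G- exists, because the map from initial data to G- is injective for
   f = 0 and acts on a finite-dimensional space; solvability for L_K follows by
   the same argument.  Two more facts give Lipschitz bounds for the map from K to
   the resolvent and for its inverse: every pair (G+, G-) is attained with
   |f| <= C (|G+| + |G-|), and for f = 0 one has |G+|, |G-| <= B |y|.  Subtract the
   solutions y = T f and y' = T' f belonging to K and K': the difference solves the
   homogeneous equation, which bounds |y - y'| by |(K - K') G+'| and, f being
   arbitrary, (K - K') G+ by |y - y'|.

   All identities for solutions are obtained by differentiating products of
   absolutely continuous functions and using that an absolutely continuous function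
   whose derivative is nonnegative a.e. is nondecreasing. *)
From HB Require Import structures.
Require Import Defs.
From mathcomp Require Import all_boot all_order all_algebra complex.
From mathcomp Require Import all_classical all_reals all_analysis.
From mathcomp Require Import measurable_realfun ring lra.
Set Implicit Arguments.
Unset Strict Implicit.
Unset Printing Implicit Defensive.
Import Order.TTheory GRing.Theory Num.Theory ComplexField.Normc.
Import numFieldNormedType.Exports.
Local Open Scope classical_set_scope.
Local Open Scope ring_scope.
Local Open Scope complex_scope.

(** * Absolutely continuous functions *)

(** The coefficients are only Lebesgue measurable, while L_2 classes are represented by Borel
    functions. So 1/p, Q/p and Q^2/p are replaced by Borel functions [r], [s], [t] equal to them
    almost everywhere, and the equation becomes a linear first-order system in (y, D^[1] y) with
    integrable coefficients. It is split into real and imaginary parts, because derivatives and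
    integrals are taken of real functions.

    The delicate point is to attain every pair (G+, G-): it prescribes y and D^[1] y at both ends at
    once, so f has to steer the system from a to b. The controls are sought among the homogeneous
    solutions of the adjoint equation, a finite-dimensional family, for which injectivity suffices.
    The bound of G+ and G- by |y| is the dual statement: pairing a homogeneous solution with a
    suitably steered one recovers its boundary values.

    The estimates for resolvents rest on five properties of the relation between f, y, G+ and G-:
    linearity, the energy inequality, solvability for given f and G-, attainability with a bound on
    f, and the bound of G+ and G- by |y|. They are derived from these in an arbitrary normed
    space. *)

Section AbsoluteContinuity.
Context (R : realType).
Implicit Types (a b : R) (f g h : R -> R).

Definition ac_on a b f : Prop :=
  forall e : R, 0 < e -> exists2 d : R, 0 < d &
    forall (n : nat) (s t : 'I_n -> R),
      (forall i, [/\ a <= s i, s i <= t i & t i <= b]) ->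
      trivIset [set: 'I_n] (fun i => `]s i, t i[%classic) ->
      \sum_(i < n) (t i - s i) < d ->
      \sum_(i < n) `|f (t i) - f (s i)| < e.

Lemma ac_on_dom2 a b f g h (C : R) : ac_on a b f -> ac_on a b g ->
  (forall u v, a <= u <= b -> a <= v <= b ->
    `|h v - h u| <= C * (`|f v - f u| + `|g v - g u|)) -> ac_on a b h.
Proof.
move=> acf acg hfg e e0.
(* [C] may be zero or negative; [C'] is positive, so [e] can be divided by it. *)
pose C' := Num.max C 1.
have C'0 : 0 < C' by rewrite lt_max ltr01 orbT.
have e2 : 0 < e / C' / 2 by rewrite !divr_gt0.
have [d1 d10 fd1] := acf _ e2; have [d2 d20 gd2] := acg _ e2.
exists (Num.min d1 d2); first by rewrite lt_min d10 d20.
move=> n s t st tI; rewrite lt_min => /andP[sd1 sd2].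
have fs := fd1 n s t st tI sd1; have gs := gd2 n s t st tI sd2.
have le1 : \sum_(i < n) `|h (t i) - h (s i)| <=
    C' * (\sum_(i < n) `|f (t i) - f (s i)| + \sum_(i < n) `|g (t i) - g (s i)|).
  rewrite -big_split/= mulr_sumr; apply: ler_sum => i _.
  have [asi sti tib] := st i.
  apply: le_trans (hfg _ _ _ _) _.
  - by rewrite asi (le_trans sti).
  - by rewrite tib (le_trans asi).
  - by rewrite ler_wpM2r ?addr_ge0// le_max lexx.
apply: (le_lt_trans le1).
rewrite [ltRHS](_ : e = C' * (e / C' / 2 + e / C' / 2)); last first.
  by field; rewrite gt_eqF.
by rewrite ltr_pM2l// ltrD.
Qed.

Lemma ac_on_dom a b f h (C : R) : ac_on a b f -> 
  (forall u v, a <= u <= b -> a <= v <= b ->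
    `|h v - h u| <= C * `|f v - f u|) -> ac_on a b h.
Proof.
move=> acf hf; apply: (@ac_on_dom2 _ _ f f _ `|C|) => // u v ub vb.
apply: le_trans (hf _ _ ub vb) _.
have : C * `|f v - f u| <= `|C| * `|f v - f u| by rewrite ler_wpM2r// ler_norm.
by move=> /le_trans; apply; rewrite ler_wpM2l// lerDl.
Qed.

Lemma ac_on_cst a b (c : R) : ac_on a b (cst c).
Proof.
move=> e e0; exists 1 => // n s t _ _ _.
by rewrite big1// => i _; rewrite /cst subrr normr0.
Qed.

Lemma ac_onD a b f g : ac_on a b f -> ac_on a b g -> ac_on a b (f \+ g).
Proof.
move=> fa ga; apply: (ac_on_dom2 (C := 1) fa ga) => u v _ _ /=.
by rewrite mul1r opprD addrACA ler_normD.
Qed.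

Lemma ac_onZ a b f (k : R) : ac_on a b f -> ac_on a b (fun x => k * f x).
Proof.
move=> fa; apply: (ac_on_dom (C := `|k|) fa) => u v _ _.
by rewrite -mulrBr normrM.
Qed.

Lemma ac_on_sub a b c d f : a <= c -> d <= b -> ac_on a b f -> ac_on c d f.
Proof.
move=> ac db fa e e0; have [d' d0 fd] := fa e e0; exists d' => // n s t st.
apply: fd => i; have [h1 h2 h3] := st i.
by split => //; [exact: le_trans h1|exact: le_trans db].
Qed.

Lemma ac_on_unif a b f (e : R) : ac_on a b f -> 0 < e ->
  exists2 d : R, 0 < d & forall u v, a <= u <= b -> a <= v <= b ->
    `|u - v| < d -> `|f u - f v| < e.
Proof.
move=> fa e0; have [d d0 fd] := fa e e0; exists d => //.
have main u v : a <= u <= b -> a <= v <= b -> u <= v -> `|u - v| < d ->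
    `|f u - f v| < e.
  move=> /andP[au ub] /andP[av vb] uv uvd.
  have := fd 1%N (fun=> u) (fun=> v); rewrite !big_ord1 distrC; apply => //.
    by move=> i j _ _ _; rewrite !ord1.
  by rewrite -[ltLHS]ger0_norm ?subr_ge0// distrC.
move=> u v ua va uvd; have [uv|/ltW vu] := leP u v; first exact: main.
by rewrite distrC; apply: main; rewrite // distrC.
Qed.

(** The retraction of the line onto [a, b]. Composition with it extends an absolutely continuous
    function to a continuous one on the whole line, to which results on continuous functions
    apply. *)
Definition clamp a b (x : R) : R := Num.max a (Num.min b x).

Lemma clamp_itv a b x : a <= b -> a <= clamp a b x <= b.
Proof. by move=> ab; rewrite /clamp le_max lexx/= ge_max ab/= ge_min lexx. Qed.

Lemma clampE a b x : a <= x <= b -> clamp a b x = x.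
Proof.
by move=> /andP[ax xb]; rewrite /clamp (min_idPr xb) (max_idPr ax).
Qed.

Lemma clamp_lip a b x y : a <= b -> `|clamp a b x - clamp a b y| <= `|x - y|.
Proof.
move=> ab; have h1 := ler_norm (x - y); have h2 := ler_norm (y - x).
rewrite (distrC y x) in h2; rewrite /clamp !maxEle !minEle.
case: (leP b x) => ?; case: (leP b y) => ? /=;
  repeat (case: ifPn; rewrite -?ltNge => ?); rewrite ler_norml; lra.
Qed.

Lemma ac_on_clamp_continuous a b f : a <= b -> ac_on a b f ->
  continuous (f \o clamp a b).
Proof.
move=> ab fa x; apply/cvgrPdist_lt => e e0.
have [d d0 fd] := ac_on_unif fa e0.
near=> y => /=; apply: fd; [exact: clamp_itv|exact: clamp_itv|].
by apply: le_lt_trans (clamp_lip _ _ ab) _; near: y; apply/nbhs_ballP; exists d.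
Unshelve. all: by end_near. Qed.

Lemma ac_on_bounded a b f : a <= b -> ac_on a b f ->
  exists2 M : R, 0 <= M & forall x, a <= x <= b -> `|f x| <= M.
Proof.
move=> ab fa; pose g := Num.norm \o (f \o clamp a b).
have gc : {within `[a, b], continuous g}.
  apply: continuous_subspaceT => x; apply: continuous_comp.
    exact: ac_on_clamp_continuous.
  exact: norm_continuous.
have [c _ gm] := EVT_max ab gc; exists (g c); first exact: normr_ge0.
move=> x xab; have := gm x; rewrite in_itv/= => /(_ xab).
by rewrite /g/= clampE.
Qed.

Lemma ac_onM a b f g : a <= b -> ac_on a b f -> ac_on a b g ->
  ac_on a b (f \* g).
Proof.
move=> ab fa ga; have [M M0 fM] := ac_on_bounded ab fa.
have [N N0 gN] := ac_on_bounded ab ga.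
apply: (ac_on_dom2 (C := M + N) fa ga) => u v uab vab /=.
rewrite (_ : f v * g v - f u * g u =
  (f v - f u) * g v + f u * (g v - g u)); last by ring.
apply: le_trans (ler_normD _ _) _; rewrite !normrM mulrDr lerD//.
  by rewrite mulrC ler_wpM2r// (le_trans (gN _ vab))// lerDr.
by rewrite ler_wpM2r// (le_trans (fM _ uab))// lerDl.
Qed.

Lemma ac_on_expR a b f : a <= b -> ac_on a b f -> ac_on a b (expR \o f).
Proof.
move=> ab fa; have [M M0 fM] := ac_on_bounded ab fa.
(* The graph of [expR] lies above its tangent at [x], so the exponential is Lipschitz with constant
   [expR M] to the left of [M]. *)
have key x y : x <= M -> y <= M -> expR x - expR y <= expR M * `|x - y|.
  move=> xM yM; have h : 1 + (y - x) <= expR (y - x) by exact: expR_ge1Dx.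
  have e0 := expR_gt0 x; have eM : expR x <= expR M by rewrite ler_expR.
  have -> : expR y = expR x * expR (y - x) by rewrite -expRD; congr expR; ring.
  apply: (@le_trans _ _ (expR x * (x - y))); first by nra.
  apply: (@le_trans _ _ (expR x * `|x - y|)).
    by apply: ler_wpM2l; [exact: ltW|exact: ler_norm].
  by apply: ler_wpM2r.
have bd x : a <= x <= b -> f x <= M by move=> /fM; exact/le_trans/ler_norm.
apply: (ac_on_dom (C := expR M) fa) => u v /bd uM /bd vM /=.
rewrite ler_norml; apply/andP; split; last exact: key.
by rewrite lerNl opprB distrC; exact: key.
Qed.

Lemma normc_ge_ReIm (z : R[i]) :
  `|complex.Re z| <= normc z /\ `|complex.Im z| <= normc z.
Proof.
by case: z => x y /=; rewrite -!sqrtr_sqr; split;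
  rewrite ler_wsqrtr// ?lerDl ?lerDr sqr_ge0.
Qed.

Lemma normc_le_ReIm (z : R[i]) :
  normc z <= `|complex.Re z| + `|complex.Im z|.
Proof.
case: z => x y /=; rewrite -[leRHS]ger0_norm ?addr_ge0// -sqrtr_sqr ler_wsqrtr//.
rewrite sqrrD !real_normK ?num_real// lerD2r lerDl.
by rewrite mulrn_wge0// mulr_ge0.
Qed.

Lemma abs_contP a b (f : R -> R[i]) : abs_cont a b f <->
  ac_on a b (fun x => complex.Re (f x)) /\
  ac_on a b (fun x => complex.Im (f x)).
Proof.
split=> [fa|[fr fi] e e0].
  split=> e /fa [d d0 fd]; exists d => // n s t st tI sd;
    apply: le_lt_trans (fd n s t st tI sd); apply: ler_sum => i _ /=.
    rewrite (_ : _ - _ = complex.Re (f (t i) - f (s i))).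
      by have [] := normc_ge_ReIm (f (t i) - f (s i)).
    by case: (f _) (f _) => [? ?] [? ?].
  rewrite (_ : _ - _ = complex.Im (f (t i) - f (s i))).
    by have [] := normc_ge_ReIm (f (t i) - f (s i)).
  by case: (f _) (f _) => [? ?] [? ?].
have e2 : 0 < e / 2 by rewrite divr_gt0.
have [d1 d10 fd1] := fr _ e2; have [d2 d20 gd2] := fi _ e2.
exists (Num.min d1 d2); first by rewrite lt_min d10 d20.
move=> n s t st tI; rewrite lt_min => /andP[sd1 sd2].
have fs := fd1 n s t st tI sd1; have gs := gd2 n s t st tI sd2.
rewrite (splitr e); apply: le_lt_trans (ltrD fs gs).
rewrite -big_split; apply: ler_sum => i _ /=.
apply: le_trans (normc_le_ReIm _) _.
by case: (f _) (f _) => [? ?] [? ?].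
Qed.

End AbsoluteContinuity.

(** * Monotonicity of absolutely continuous functions with nonnegative derivative *)

Section Monotonicity.
Context (R : realType).
Implicit Types (a b : R) (f g : R -> R).
Local Notation mu := (@lebesgue_measure R).

(** Let c be the supremum of the points x with [P a x]. The local hypothesis at c joins a point just
    below c to c and beyond, which contradicts the choice of c unless c = b. *)
Lemma cousin_ind a b (P : R -> R -> Prop) : a <= b ->
  (forall u v w, u <= v -> v <= w -> P u v -> P v w -> P u w) ->
  (forall x, a <= x <= b -> exists2 d, 0 < d & forall u v,
    a <= u -> u <= x -> x <= v -> v <= b -> x - d < u -> v < x + d -> P u v) ->
  P a b.
Proof.
move=> ab Ptrans Ploc.
pose S := [set x | a <= x <= b /\ P a x].
have Sa : S a.
  have [|d d0 Pd] := Ploc a; first by rewrite lexx.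
  split; first by rewrite lexx.
  by apply: Pd => //; rewrite ?ltrBlDr ?ltrDl.
have Sub : has_sup S by split; [exists a|exists b => x [/andP[]]].
have Sc x : S x -> x <= sup S by move=> Sx; apply: sup_upper_bound.
set c := sup S in Sc.
have cab : a <= c <= b.
  rewrite Sc//=; apply: ge_sup; first by case: Sub.
  by move=> x [/andP[]].
have [d d0 Pd] := Ploc c cab.
have [s Ss cds] : exists2 s, S s & c - d < s.
  by have [s Ss cds] := sup_adherent d0 Sub; exists s.
have sc := Sc _ Ss; have [/andP[as_ sb] Pas] := Ss.
have [ac cb] := andP cab.
pose v := Num.min b (c + d / 2).
have d2 : 0 < d / 2 by rewrite divr_gt0.
have cv : c <= v by rewrite le_min cb/= lerDl ltW.
have vb : v <= b by rewrite ge_min lexx.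
have vd : v < c + d by rewrite gt_min; apply/orP; right; rewrite ltrD2l; lra.
have Pav : P a v.
  by apply: (Ptrans a s v) => //; [exact: le_trans cv|exact: Pd].
have Sv : S v by split => //; rewrite vb (le_trans ac).
have vc := Sc _ Sv.
have : v = b.
  by apply/eqP; rewrite eq_le vb/= leNgt; apply/negP; rewrite /v gt_min ltxx/=;
    move: vc; rewrite /v ge_min => /orP[bc|]; lra.
by move=> <-.
Qed.

(** The intervals of [l] are ordered from left to right inside [u, v] without overlap, and gaps are
    allowed. With lists, gluing two adjacent pieces of [a, b] is concatenation. *)
Fixpoint chain (u : R) (l : seq (R * R)) (v : R) : bool :=
  if l is p :: l' then [&& u <= p.1, p.1 <= p.2 & chain p.2 l' v] else u <= v.

Lemma chain_le u l v : chain u l v -> u <= v.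
Proof.
elim: l u => //= p l IH u /and3P[up pp /IH pv].
by rewrite (le_trans up)// (le_trans pp).
Qed.

Lemma chain_weak u u' l v : u' <= u -> chain u l v -> chain u' l v.
Proof.
case: l => [|p l] /= uu; first exact: le_trans.
by move=> /and3P[up -> ->]; rewrite (le_trans uu).
Qed.

Lemma chain_cat u l1 v l2 w : chain u l1 v -> chain v l2 w ->
  chain u (l1 ++ l2) w.
Proof.
elim: l1 u => [|p l IH] u /=; first exact: chain_weak.
by move=> /and3P[-> -> lv] vw; rewrite IH.
Qed.

Lemma chain_nth u l v (i : nat) : chain u l v -> (i < size l)%N ->
  [/\ u <= (nth (0, 0) l i).1, (nth (0, 0) l i).1 <= (nth (0, 0) l i).2 &
      (nth (0, 0) l i).2 <= v].
Proof.
elim: l u i => //= p l IH u [|i] /and3P[up pp pv] il /=.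
  by split => //; exact: chain_le pv.
have [h1 h2 h3] := IH _ _ pv il; split => //.
by rewrite (le_trans up)// (le_trans pp).
Qed.

Lemma chain_nth_lt u l v (i j : nat) : chain u l v -> (i < j < size l)%N ->
  (nth (0, 0) l i).2 <= (nth (0, 0) l j).1.
Proof.
elim: l u i j => [|p l IH] u i [|j] /=; rewrite ?ltn0 ?andbF//.
case: i => [|i] /and3P[up pp pv] ij; last exact: IH pv ij.
by have [] := @chain_nth _ _ _ j pv ij.
Qed.

(** The leftmost interval is disjoint from the part of [U] beyond its right end, so additivity of
    the measure lets it be peeled off. *)
Lemma chain_measure (U : set R) u l v : measurable U -> chain u l v ->
  (forall p, p \in l -> `]p.1, p.2[ `<=` U) ->
  ((\sum_(p <- l) (p.2 - p.1))%:E <= mu (U `&` `]u, v[))%E.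
Proof.
move=> mU; elim: l u => [|p l IH] u; first by rewrite big_nil.
move=> /= /and3P[up pp pv] lU; rewrite big_cons EFinD.
have pvle := chain_le pv.
have {IH}IHl : ((\sum_(p <- l) (p.2 - p.1))%:E <= mu (U `&` `]p.2, v[))%E.
  by apply: IH => // q ql; apply: lU; rewrite inE ql orbT.
have -> : ((p.2 - p.1)%:E = mu `]p.1, p.2[)%E.
  by rewrite lebesgue_measure_itv/= lte_fin; case: ltgtP pp => // ->; rewrite subrr.
apply: le_trans (leeD2l _ IHl) _.
rewrite -measureU//.
- apply: le_measure; rewrite ?inE//.
  + by apply: measurableU => //; apply: measurableI.
  + exact: measurableI.
  + move=> x [xp|[Ux xv]].
      split; first by apply: (lU p) => //; rewrite inE eqxx.
      by move: xp; rewrite /= !in_itv/= => /andP[px xp2];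
        rewrite (le_lt_trans up)//= (lt_le_trans xp2).
    split => //; move: xv; rewrite /= !in_itv/= => /andP[px ->]; rewrite andbT.
    by rewrite (le_lt_trans up)// (le_lt_trans pp).
- exact: measurableI.
- rewrite -subset0 => x [/=]; rewrite !in_itv/= => /andP[_ xp] [_ /andP[px _]].
  by rewrite ltNge ltW in px.
Qed.

(** Straddle lemma: the derivative controls only increments with one end at x, so the increment over
    [u, v] is split at x. *)
Lemma derive_ge_local f (x l e : R) : is_derive x (1 : R) f l -> 0 <= l -> 0 < e ->
  exists2 d, 0 < d & forall u v, u <= x -> x <= v -> x - d < u -> v < x + d ->
    f u - f v <= e * (v - u).
Proof.
move=> [df <-] l0 e0; move: df => /cvgrPdist_le /(_ e e0).
rewrite -/(derive f x 1) => -[d /= d0 dP].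
have {}dP (h : R) : h != 0 -> `|h| < d ->
    `|f (h + x) - f x - 'D_1 f x * h| <= e * `|h|.
  move=> h0 hd;
  have := dP h; rewrite /ball_ /= add0r normrN => /(_ hd h0).
  rewrite -(@ler_pM2r _ `|h|) ?normr_gt0// -normrM; congr (_ <= _).
  rewrite -normrN [h%:A](mulr1 h); congr `|_|.
  rewrite -[_ *: _]/(h^-1 * _); field; exact: h0.
exists d => // u v ux xv du vd.
have fv : f x - f v <= e * (v - x).
  have [->|vx] := eqVneq v x; first by rewrite !subrr mulr0.
  have := dP (v - x); rewrite subr_eq0 subrK => /(_ vx).
  rewrite ger0_norm ?subr_ge0// => /(_ _)/le_trans.
  have {}xv : 0 <= v - x by rewrite subr_ge0.
  have Dv : 0 <= 'D_1 f x * (v - x) by rewrite mulr_ge0.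
  have vxd : v - x < d by lra.
  move=> /(_ _ vxd (lexx _)); rewrite ler_norml => /andP[+ _]; lra.
have fu : f u - f x <= e * (x - u).
  have [->|vx] := eqVneq u x; first by rewrite !subrr mulr0.
  have := dP (u - x); rewrite subr_eq0 subrK => /(_ vx).
  rewrite distrC ger0_norm ?subr_ge0// => /(_ _)/le_trans.
  have {}ux : 0 <= x - u by rewrite subr_ge0.
  have Dv : 0 <= 'D_1 f x * (x - u) by rewrite mulr_ge0.
  have vxd : x - u < d by lra.
  move=> /(_ _ vxd (lexx _)); rewrite ler_norml => /andP[_ +]; lra.
by lra.
Qed.

(** Outer regularity is applied to the exceptional null set together with the endpoints, about which
    [ae_on] says nothing. *)
Lemma ae_on_open_cover a b (P : R -> Prop) (d : R) : 0 < d -> ae_on a b P ->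
  exists U : set R, [/\ open U, (mu U < d%:E)%E, U a, U b &
    forall x, a <= x <= b -> ~ U x -> a < x < b /\ P x].
Proof.
move=> d0 [N [mN N0 PN]].
have mab : measurable ([set a] `|` [set b] : set R) by exact: measurableU.
have s0 (c : R) : mu [set c] = 0%E by exact: lebesgue_measure_set1.
have ab0 : mu ([set a] `|` [set b]) = 0%E.
  by rewrite -[RHS](s0 a); apply: (@measureU0 _ _ _ mu)   => //; exact: s0.
have N'0 : mu (N `|` ([set a] `|` [set b])) = 0%E.
  by rewrite -[RHS]N0; apply: (@measureU0 _ _ _ mu).
have mN' : measurable (N `|` ([set a] `|` [set b])) by exact: measurableU.
have [|U [oU NU muU]] := lebesgue_regularity_outer mN' _ d0.
  by rewrite [X in (X < _)%E]N'0 ltry.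
exists U; split => //.
- have mU : measurable U by exact: open_measurable.
  apply: le_lt_trans muU; rewrite -[X in mu X](setDUK NU) setUC.
  rewrite [leLHS](@measureU0 _ _ _ mu)//; exact: measurableD.
- by apply: NU; right; left.
- by apply: NU; right; right.
move=> x /andP[ax xb] nU.
have xa : x != a by apply/eqP => xa; apply: nU; apply: NU; right; left.
have xb' : x != b by apply/eqP => xeb; apply: nU; apply: NU; right; right.
have axb : a < x < b by rewrite !lt_neqAle ax xb xb' eq_sym xa.
split => //; apply: contrapT => nP; apply: nU; apply: NU; left.
by apply: PN => /= /(_ axb).
Qed.

(* Cousin's lemma cuts [a, b] into intervals on which f decreases slowly and
   intervals covered by an open set of small measure, on which the variation of
   f is small by absolute continuity. *)
Lemma ac_on_le a b f : a <= b -> ac_on a b f ->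
  ae_on a b (fun x => exists2 l : R, 0 <= l & is_derive x (1 : R) f l) -> f a <= f b.
Proof.
move=> ab fa aef.
suff main e : 0 < e -> f a - f b <= e * (b - a) + e.
  rewrite leNgt; apply/negP => fba.
  have ba : 0 <= b - a by rewrite subr_ge0.
  (* With this [e] the bound of [main] is half of the supposed decrease [f a - f b], a
     contradiction. *)
  pose e := (f a - f b) / (2 * (b - a + 1)).
  have e0 : 0 < e by rewrite /e divr_gt0 ?subr_gt0// mulr_gt0// ltr_wpDl.
  have := main e e0; have -> : e * (b - a) + e = e * (b - a + 1) by ring.
  have -> : e * (b - a + 1) = (f a - f b) / 2.
    by rewrite /e; field; lra.
  lra.
move=> e0; have [d d0 fd] := fa e e0.
have [U [oU muU Ua Ub UP]] := ae_on_open_cover d0 aef.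
(* The list [l] collects the pieces lying in [U]. A piece around a point outside [U] contributes no
   interval, only the term [e * (v - u)]. *)
pose P u v := exists l, [/\ chain u l v,
  (forall p, p \in l -> `]p.1, p.2[ `<=` U) &
  f u - f v <= e * (v - u) + \sum_(p <- l) `|f p.2 - f p.1|].
have [l [lc lU lf]] : P a b.
  apply: cousin_ind => //.
    move=> u v w uv vw [l1 [l1c l1U l1f]] [l2 [l2c l2U l2f]].
    exists (l1 ++ l2); split; first exact: chain_cat l1c l2c.
      by move=> p; rewrite mem_cat => /orP[/l1U|/l2U].
    by rewrite big_cat/=; lra.
  move=> x xab; have [Ux|nUx] := pselect (U x).
    have /nbhs_ballP[r /= r0 rU] : nbhs x U by exact: open_nbhs_nbhs.
    exists r => // u v au ux xv vb ru vr.
    exists [:: (u, v)]; split => /=.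
    - by rewrite !lexx (le_trans ux).
    - move=> p; rewrite inE => /eqP -> /= y; rewrite /= in_itv/= => /andP[uy yv].
      apply: rU; rewrite /ball/= ltr_distlC; apply/andP; split; lra.
    - rewrite big_seq1/=; have := ler_norm (f u - f v); rewrite distrC.
      have : 0 <= e * (v - u).
        by apply: mulr_ge0; [exact: ltW|rewrite subr_ge0 (le_trans ux)].
      lra.
  have [xab' [l0 l00 dl]] := UP _ xab nUx.
  have [r r0 rP] := derive_ge_local dl l00 e0.
  exists r => // u v au ux xv vb ru vr; exists [::]; split => //=.
    exact: le_trans xv.
  by rewrite big_nil addr0; exact: rP.
apply: le_trans lf _; rewrite lerD2l ltW//.
have := fd (size l) (fun i => (nth (0, 0) l i).1) (fun i => (nth (0, 0) l i).2).
rewrite (big_nth (0, 0)) big_mkord; apply.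
- by move=> i; exact: chain_nth lc _.
- move=> i j _ _ [x []] /=; rewrite !in_itv/= => /andP[xi1 xi2] /andP[xj1 xj2].
  apply/val_inj/eqP; case: ltngtP => // ij.
  + have := @chain_nth_lt _ _ _ i j lc; rewrite ij ltn_ord => /(_ isT); lra.
  + have := @chain_nth_lt _ _ _ j i lc; rewrite ij ltn_ord => /(_ isT); lra.
rewrite -(big_mkord xpredT (fun i => (nth (0, 0) l i).2 - (nth (0, 0) l i).1)).
rewrite -(big_nth (0, 0) xpredT (fun p => p.2 - p.1)) -lte_fin.
have mU : measurable U by exact: open_measurable.
apply: le_lt_trans (chain_measure mU lc lU) _.
apply: le_lt_trans muU; apply: le_measure; rewrite ?inE//.
exact: measurableI.
Qed.

End Monotonicity.

(** * Primitives of integrable functions and their calculus *)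

Section Primitives.
Context (R : realType).
Implicit Types (a b : R) (f g h : R -> R).
Local Notation mu := (@lebesgue_measure R).

Lemma ae_onT a b (P : R -> Prop) : (forall x, a < x < b -> P x) -> ae_on a b P.
Proof. by move=> PT; apply: nearW. Qed.

Lemma ae_on_sub (P Q : R -> Prop) a b c d : a <= c -> d <= b -> ae_on a b P ->
  (forall x, c < x < d -> P x -> Q x) -> ae_on c d Q.
Proof.
move=> ac db aP PQ; move: aP; rewrite /ae_on.
apply: (@filterS _ _ (ae_filter_ringOfSetsType mu)) => x Px /andP[cx xd].
apply: PQ; first by rewrite cx.
by apply: Px; rewrite (le_lt_trans ac)// (lt_le_trans xd).
Qed.

Lemma ae_onS (P Q : R -> Prop) a b : ae_on a b P ->
  (forall x, a < x < b -> P x -> Q x) -> ae_on a b Q.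
Proof. exact: ae_on_sub. Qed.

Lemma ae_onI (P Q : R -> Prop) a b : ae_on a b P -> ae_on a b Q ->
  ae_on a b (fun x => P x /\ Q x).
Proof.
move=> aP aQ; move: aP aQ; rewrite /ae_on.
apply: (@filterS2 _ _ (ae_filter_ringOfSetsType mu)) => x Px Qx xab.
by split; [exact: Px|exact: Qx].
Qed.

(** Stands for the identity f(x) = f(a) + \int_a^x g. Calculus is done on such pairs, by the product
    and chain rules, instead of on integrals. *)
Definition ac_prim a b f g : Prop :=
  ac_on a b f /\ ae_on a b (fun x => is_derive x (1 : R) f (g x)).

Lemma ac_prim_ext a b f g h : ac_prim a b f g ->
  ae_on a b (fun x => g x = h x) -> ac_prim a b f h.
Proof.
move=> [fa fg] gh; split=> //.
by apply: ae_onS (ae_onI fg gh) _ => x _ [+ <-].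
Qed.

Lemma ac_prim_cst a b (c : R) : ac_prim a b (fun=> c) (fun=> 0).
Proof.
by split; [exact: ac_on_cst|apply: ae_onT => x _; exact: is_derive_cst].
Qed.

Lemma ac_primD a b f1 g1 f2 g2 : ac_prim a b f1 g1 -> ac_prim a b f2 g2 ->
  ac_prim a b (fun x => f1 x + f2 x) (fun x => g1 x + g2 x).
Proof.
move=> [fa1 fg1] [fa2 fg2]; split; first exact: ac_onD.
by apply: ae_onS (ae_onI fg1 fg2) _ => x _ [d1 d2]; exact: is_deriveD.
Qed.

Lemma ac_primZ a b (k : R) f g : ac_prim a b f g ->
  ac_prim a b (fun x => k * f x) (fun x => k * g x).
Proof.
move=> [fa fg]; split; first exact: ac_onZ.
by apply: ae_onS fg _ => x _ d; exact: is_deriveZ.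
Qed.

Lemma ac_primN a b f g : ac_prim a b f g ->
  ac_prim a b (fun x => - f x) (fun x => - g x).
Proof.
move=> /(ac_primZ (-1)).
by under eq_fun do rewrite mulN1r; under [X in ac_prim _ _ _ X]eq_fun do rewrite mulN1r.
Qed.

Lemma ac_primB a b f1 g1 f2 g2 : ac_prim a b f1 g1 -> ac_prim a b f2 g2 ->
  ac_prim a b (fun x => f1 x - f2 x) (fun x => g1 x - g2 x).
Proof. by move=> h1 /ac_primN; exact: ac_primD. Qed.

Lemma ac_primM a b f1 g1 f2 g2 : a <= b ->
  ac_prim a b f1 g1 -> ac_prim a b f2 g2 ->
  ac_prim a b (fun x => f1 x * f2 x) (fun x => f1 x * g2 x + f2 x * g1 x).
Proof.
move=> ab [fa1 fg1] [fa2 fg2]; split; first exact: ac_onM.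
by apply: ae_onS (ae_onI fg1 fg2) _ => x _ [d1 d2]; exact: is_deriveM.
Qed.

Lemma ac_prim_expR a b f g : a <= b -> ac_prim a b f g ->
  ac_prim a b (fun x => expR (f x)) (fun x => expR (f x) * g x).
Proof.
move=> ab [fa fg]; split; first exact: ac_on_expR.
apply: ae_onS fg _ => x _ d.
exact: (@is_derive1_comp _ expR f).
Qed.

(** Takes the place of integrating an inequality between derivatives: [ac_on_le] is applied to f2 -
    f1 on [x, y]. *)
Lemma ac_prim_le a b f1 g1 f2 g2 : ac_prim a b f1 g1 -> ac_prim a b f2 g2 ->
  ae_on a b (fun x => g1 x <= g2 x) ->
  forall x y, a <= x -> x <= y -> y <= b -> f1 y - f1 x <= f2 y - f2 x.
Proof.
move=> fg1 fg2 g12 x y ax xy yb.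
have [fa fg] := ac_primB fg2 fg1.
suff : f2 x - f1 x <= f2 y - f1 y by lra.
apply: (@ac_on_le _ x y (fun x => f2 x - f1 x)) => //; first exact: ac_on_sub fa.
apply: ae_on_sub (ae_onI fg g12) _ => // z _ [d gz].
by exists (g2 z - g1 z) => //; rewrite subr_ge0.
Qed.

(** The derivative is given by Lebesgue's differentiation theorem. Absolute continuity holds because
    the integral of |g| over sets of small measure is small. *)
Lemma ac_prim_Rintegral a b g : mu.-integrable setT (EFin \o g) ->
  ac_prim a b (fun x => \int[mu]_(t in `]-oo, x]) g t) g.
Proof.
move=> ig; set F := (fun x => _).
have igS (D : set R) : measurable D -> mu.-integrable D (EFin \o g).
  by move=> mD; exact: integrableS ig.
have igN (D : set R) : measurable D ->
    mu.-integrable D (fun x => `|g x|%:E).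
  by move=> mD; exact: (integrable_abse (igS _ mD)).
split; last first.
  have locg : locally_integrable [set: R] g.
    rewrite -(_ : g \_ setT = g); last by rewrite patch_setT.
    exact: integrable_locally.
  have /= := FTC1Ny (fun y => igS _ (measurable_itv _)) locg.
  apply: (@filterS _ _ (ae_filter_ringOfSetsType mu)) => x [dF F'] _.
  exact: (DeriveDef dF (etrans (esym (derive1E F x)) F')).
have Fuv u v : u <= v -> `|F v - F u| <= \int[mu]_(t in `]u, v]) `|g t|.
  move=> uv; rewrite /F Rintegral_itvB ?bnd_simp//; last exact: igS.
  by apply: le_normr_Rintegral => //; exact: igS.
move=> e e0; have [d [d0 gd]] := integral_normr_continuous ig e0.
exists d => // n s t st tI sd.
(* Disjointness is given for the open intervals only. If x lies in two half-open ones, the midpoint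
   of x and the larger left end lies in both open ones. *)
have tI' : trivIset [set` index_enum 'I_n] (fun i => `]s i, t i]%classic).
  move=> i j _ _ [x []]; rewrite /= !in_itv/= => /andP[sx xt] /andP[sx' xt'].
  apply: tI => //; exists ((Num.max (s i) (s j) + x) / 2).
  have mx : Num.max (s i) (s j) < x by rewrite gt_max sx.
  have m1 : s i <= Num.max (s i) (s j) by rewrite le_max lexx.
  have m2 : s j <= Num.max (s i) (s j) by rewrite le_max lexx orbT.
  by split; rewrite /= in_itv/=; apply/andP; split; lra.
pose D := \big[setU/set0]_(i < n) `]s i, t i]%classic.
have mD : measurable D by apply: bigsetU_measurable.
have muD : (mu D < d%:E)%E.
  rewrite /D (@measure_bigsetU_ord _ _ _ mu)//; last first.
    by move=> i j _ _; apply: tI' => /=; rewrite mem_index_enum.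
  move: sd; rewrite -lte_fin -sumEFin; apply: le_lt_trans.
  apply: lee_sum => i _; have [_ sti _] := st i.
  have muI : mu `]s i, t i] = (t i - s i)%:E.
    rewrite lebesgue_measure_itv/= lte_fin.
    by case: ltgtP sti => // ->; rewrite subrr.
  by rewrite -muI.
apply: le_lt_trans (gd _ mD muD).
rewrite -lee_fin /Rintegral fineK; last first.
  by apply: (@integrable_fin_num _ _ _ mu D) => //; exact: igN.
rewrite (@ge0_integral_bigsetU _ _ _ mu _ _ _ _ _ _ tI')//; last 2 first.
- exact: index_enum_uniq.
- exact: measurable_int (igN _ mD).
rewrite -sumEFin; apply: lee_sum => i _.
have sti : s i <= t i by have [] := st i.
apply: (@le_trans _ _ (\int[mu]_(t in `]s i, t i]) `|g t|)%:E).
  by rewrite lee_fin Fuv.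
rewrite /Rintegral fineK// (@integrable_fin_num _ _ _ mu)//.
exact: igN.
Qed.

(** Once [g] is extended by zero outside ]a, b[, its primitive from -oo vanishes at a and equals the
    whole integral at b. *)
Lemma ac_prim_exists a b g : a <= b -> mu.-integrable `]a, b[ (EFin \o g) ->
  exists f, [/\ f a = 0, ac_prim a b f g &
    f b = \int[mu]_(t in `]a, b[) g t].
Proof.
move=> ab ig; pose G := g \_ `]a, b[.
have iG : mu.-integrable setT (EFin \o G).
  by rewrite -restrict_EFin; apply/integrable_restrict => //=; rewrite setTI.
exists (fun x => \int[mu]_(t in `]-oo, x]) G t); split.
- rewrite (@eq_Rintegral _ _ _ mu _ (cst 0)).
    by rewrite Rintegral_cst// mul0r.
  move=> x; rewrite inE/= in_itv/= => xa; rewrite /G patchE.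
  by rewrite memNset//= in_itv/= => /andP[]; lra.
- apply: ac_prim_ext (ac_prim_Rintegral a b iG) _; apply: ae_onT => x xab.
  by rewrite /G patchE mem_set.
- rewrite -Rintegral_mkcondr; congr Rintegral; apply/setIidPr => x /=.
  by rewrite !in_itv/= => /andP[_ /ltW].
Qed.

End Primitives.

Section IntegrableOnInterval.
Context (R : realType).
Implicit Types (a b : R) (f g h : R -> R).
Local Notation mu := (@lebesgue_measure R).

Definition L1_on a b g : Prop := mu.-integrable `]a, b[ (EFin \o g).

Lemma L1_on_measurable a b g : L1_on a b g -> measurable_fun `]a, b[ g.
Proof. by move=> /(measurable_int mu)/measurable_EFinP. Qed.

Lemma L1_onD a b f g : L1_on a b f -> L1_on a b g ->
  L1_on a b (fun x => f x + g x).
Proof.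
move=> fi gi; rewrite /L1_on (_ : _ \o _ = (EFin \o f) \+ (EFin \o g))%E //.
exact: integrableD.
Qed.

Lemma L1_on_sum a b (n : nat) (f : 'I_n -> R -> R) :
  (forall i, L1_on a b (f i)) -> L1_on a b (fun x => \sum_(i < n) f i x).
Proof.
move=> fi; rewrite /L1_on.
rewrite (_ : _ \o _ = fun x => (\sum_(i < n) (f i x)%:E)%E); last first.
  by apply/funext => x /=; rewrite sumEFin.
by apply: integrable_sum => // i _; exact: fi.
Qed.

Lemma L1_on_le a b f g : measurable_fun `]a, b[ f -> L1_on a b g ->
  (forall x, a < x < b -> `|f x| <= `|g x|) -> L1_on a b f.
Proof.
move=> mf gi fg; apply: le_integrable gi => //.
exact/measurable_EFinP.
Qed.

Lemma L1_on_norm a b f : L1_on a b f -> L1_on a b (fun x => `|f x|).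
Proof.
move=> fi; apply: L1_on_le (fi) _ => [|x _]; last by rewrite normr_id.
by apply: measurableT_comp => //; exact: L1_on_measurable.
Qed.

Lemma L1_onM_bounded a b f h (C : R) : L1_on a b f ->
  measurable_fun `]a, b[ h -> (forall x, a < x < b -> `|h x| <= C) ->
  L1_on a b (fun x => f x * h x).
Proof.
move=> fi mh hC; have : L1_on a b (fun x => C * f x).
  by rewrite /L1_on (_ : _ \o _ = fun x => (C%:E * (f x)%:E)%E)//; exact: integrableZl.
move=> Cf; apply: L1_on_le Cf _ => [|x /hC hx].
  by apply: measurable_funM => //; exact: L1_on_measurable.
rewrite !normrM mulrC ler_wpM2r// (le_trans hx)//; exact: ler_norm.
Qed.

Lemma ac_on_measurable a b f : a <= b -> ac_on a b f -> measurable_fun `]a, b[ f.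
Proof.
move=> ab fa; apply: (@eq_measurable_fun _ _ _ _ _ (f \o clamp a b)).
  move=> x; rewrite inE/= in_itv/= => /andP[ax xb].
  by rewrite clampE// !ltW.
apply: measurable_funTS; apply: continuous_measurable_fun.
exact: ac_on_clamp_continuous.
Qed.


Lemma ac_prim_norm_le a b f g h k : ac_prim a b f g -> ac_prim a b h k ->
  ae_on a b (fun x => `|g x| <= k x) -> `|f a| <= h a ->
  forall x, a <= x <= b -> `|f x| <= h x.
Proof.
move=> fg hk gk fha x /andP[ax xb].
have le1 : ae_on a b (fun x => g x <= k x).
  by apply: ae_onS gk _ => y _; exact/le_trans/ler_norm.
have le2 : ae_on a b (fun x => - g x <= k x).
  by apply: ae_onS gk _ => y _; rewrite -normrN; exact/le_trans/ler_norm.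
have h1 := ac_prim_le fg hk le1 (lexx a) ax xb.
have h2 := ac_prim_le (ac_primN fg) hk le2 (lexx a) ax xb.
by move: fha; rewrite !ler_norml => /andP[h3 h4]; apply/andP; split; lra.
Qed.

End IntegrableOnInterval.

(** * Linear systems with integrable coefficients *)

Section LinearSystem.
Context (R : realType).

(** The intervals with centre u_k and radius 2 C / 2^k are nested, so the supremum of their left
    ends lies in all of them. This yields the limit together with its rate. *)
Lemma geometric_lim (u : nat -> R) (C : R) : 0 <= C ->
  (forall k, `|u k.+1 - u k| <= C / 2 ^+ k) ->
  exists l, forall k, `|l - u k| <= 2 * C / 2 ^+ k.
Proof.
move=> C0 uC; have p k : 0 < (2 : R) ^+ k by rewrite exprn_gt0.
pose A k := u k - 2 * C / 2 ^+ k; pose B k := u k + 2 * C / 2 ^+ k.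
have step k : A k <= A k.+1 /\ B k.+1 <= B k.
  have := uC k; rewrite ler_norml => /andP[h1 h2].
  have -> : A k.+1 = u k.+1 - C / 2 ^+ k.
    by rewrite /A exprS; congr (_ - _); field; rewrite gt_eqF.
  have -> : B k.+1 = u k.+1 + C / 2 ^+ k.
    by rewrite /B exprS; congr (_ + _); field; rewrite gt_eqF.
  by rewrite /A /B -mulrA; split; lra.
have AB k : A k <= B k.
  by rewrite /A /B lerD2l -subr_ge0 opprK addr_ge0// mulr_ge0// ?mulr_ge0// invr_ge0 ltW.
have mono j k : A j <= A (j + k)%N /\ B (j + k)%N <= B j.
  elim: k => [|k [h1 h2]]; first by rewrite addn0.
  have [h3 h4] := step (j + k)%N; rewrite addnS; split; lra.
have ABjk j k : A j <= B k.
  have [h1 _] := mono j k; have [_ h2] := mono k j.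
  by rewrite addnC in h2; apply: le_trans h1 (le_trans (AB _) h2).
have sA : has_sup (range A).
  by split; [exists (A 0%N), 0%N|exists (B 0%N) => _ [k _ <-]].
exists (sup (range A)) => k.
have h1 : A k <= sup (range A) by apply: sup_upper_bound => //; exists k.
have h2 : sup (range A) <= B k.
  by apply: ge_sup; [case: sA|move=> _ [j _ <-]].
by rewrite ler_norml; move: h1 h2; rewrite /A /B => *; apply/andP; split; lra.
Qed.

Variables (a b : R) (ab : a <= b) (n : nat).
Variables (M : 'I_n -> 'I_n -> R -> R) (F : 'I_n -> R -> R) (c : 'I_n -> R).
Hypothesis iM : forall i j, L1_on a b (M i j).
Hypothesis iF : forall i, L1_on a b (F i).

Let rhs (w : 'I_n -> R -> R) i x := \sum_(j < n) M i j x * w j x + F i x.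

(** Enough for the right-hand side to be integrable, and available for the limit of the iterates
    before its absolute continuity is known. *)
Let ok (w : 'I_n -> R -> R) := forall i, measurable_fun `]a, b[ (w i) /\
  exists C : R, forall x, a < x < b -> `|w i x| <= C.

Let ac_ok w : (forall i, ac_on a b (w i)) -> ok w.
Proof.
move=> wa i; split; first exact: ac_on_measurable.
have [C _ wC] := ac_on_bounded ab (wa i); exists C => x /andP[ax xb].
by apply: wC; rewrite !ltW.
Qed.

Let step w : ok w -> exists w' : 'I_n -> R -> R,
  forall i, w' i a = c i /\ ac_prim a b (w' i) (rhs w i).
Proof.
move=> wok; have ex i : exists f, f a = c i /\ ac_prim a b f (rhs w i).
  have irhs : L1_on a b (rhs w i).
    apply: L1_onD => //; apply: L1_on_sum => j.
    by have [mw [C wC]] := wok j; exact: L1_onM_bounded wC.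
  have [f [fa0 fP _]] := ac_prim_exists ab irhs.
  exists (fun x => f x + c i); split; first by rewrite fa0 add0r.
  apply: ac_prim_ext (ac_primD fP (ac_prim_cst a b (c i))) _.
  by apply: ae_onT => x _; rewrite addr0.
by have [w' w'P] := choice ex; exists w'.
Qed.

(* Picard iteration; in the norm weighted by exp(2 m), where m is a primitive of
   the sum of the |M i j|, each step contracts by the factor 1/2. *)
Lemma linear_system_exists : exists w : 'I_n -> R -> R,
  forall i, w i a = c i /\
    ac_prim a b (w i) (fun x => \sum_(j < n) M i j x * w j x + F i x).
Proof.
pose K (x : R) : R := \sum_(i < n) \sum_(j < n) `|M i j x|.
have iK : L1_on a b K.
  by apply: L1_on_sum => i; apply: L1_on_sum => j; exact: L1_on_norm.
have [m [ma0 mP _]] := ac_prim_exists ab iK.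
pose E (x : R) : R := expR (2 * m x).
have EP : ac_prim a b E (fun x => E x * (2 * K x)).
  exact: ac_prim_expR ab (ac_primZ 2 mP).
have E0 x : 0 < E x by exact: expR_gt0.
have MK i x (v : 'I_n -> R) B : (forall j, `|v j| <= B) ->
    `|\sum_(j < n) M i j x * v j| <= K x * B.
  move=> vB; apply: le_trans (ler_norm_sum _ _ _) _.
  rewrite /K [X in _ <= X * _](bigD1 i)//= mulrDl -[leLHS]addr0 lerD//.
    rewrite mulr_suml; apply: ler_sum => j _.
    by rewrite normrM ler_wpM2l.
  apply: mulr_ge0; first by apply: sumr_ge0 => k _; apply: sumr_ge0.
  exact: le_trans (vB i).
(* The iteration runs on a sigma type, since a step exists only for families on which the right-hand
   side is integrable. *)
have stepS (w : {w : 'I_n -> R -> R | forall i, ac_on a b (w i)}) :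
    exists w' : {w : 'I_n -> R -> R | forall i, ac_on a b (w i)},
    forall i, sval w' i a = c i /\ ac_prim a b (sval w' i) (rhs (sval w) i).
  have [w' w'P] := step (ac_ok (svalP w)).
  have w'ac i : ac_on a b (w' i) by have [_ []] := w'P i.
  by exists (exist _ w' w'ac).
have [G GP] := choice stepS.
have w0ac i : ac_on a b (fun=> c i) by exact: ac_on_cst.
pose G0 : {w : 'I_n -> R -> R | forall i, ac_on a b (w i)} :=
  exist _ (fun i => (fun=> c i)) w0ac.
pose W k := sval (iter k G G0).
have Wac k i : ac_on a b (W k i) by exact: (svalP (iter k G G0)).
have WS k i : W k.+1 i a = c i /\ ac_prim a b (W k.+1 i) (rhs (W k) i).
  exact: (GP (iter k G G0) i).
have Wa k i : W k i a = c i by case: k => [//|k]; have [] := WS k i.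
have WP k i : ac_prim a b (W k.+1 i) (rhs (W k) i) by have [] := WS k i.
have [C C0 CP] : exists2 C : R, 0 <= C & forall i x, a <= x <= b ->
    `|W 1%N i x - W 0%N i x| <= C * E x.
  have ex i : exists C : R, 0 <= C /\ forall x, a <= x <= b ->
      `|W 1%N i x - W 0%N i x| <= C.
    have [|C C0 CP] := @ac_on_bounded _ a b (fun x => W 1%N i x - W 0%N i x) ab.
      apply: (ac_onD (Wac 1%N i) _).
      by have := ac_onZ (-1) (Wac 0%N i); under eq_fun do rewrite mulN1r.
    by exists C.
  have [C CP] := choice ex.
  (* [L] bounds |2 m| on [a, b], hence expR L * E x >= 1, and a plain bound turns into a multiple of
     the weight [E]. *)
  have [L L0 mL] := ac_on_bounded ab (ac_onZ 2 (proj1 mP)).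
  exists (\sum_i C i * expR L).
    by apply: sumr_ge0 => i _; rewrite mulr_ge0 ?expR_ge0//; have [] := CP i.
  move=> i x xab; have [Ci0 CiP] := CP i.
  apply: le_trans (CiP _ xab) _.
  rewrite [X in _ <= X * _](bigD1 i)//= mulrDl -[leLHS]addr0 lerD//.
    rewrite -mulrA ler_peMr// /E -expRD; apply: le_trans (expR_ge1Dx _).
    have := mL _ xab; rewrite ler_norml => /andP[h _]. lra.
  apply: mulr_ge0; last exact: expR_ge0.
  by apply: sumr_ge0 => j _; rewrite mulr_ge0 ?expR_ge0//; have [] := CP j.
have dW k : forall i x, a <= x <= b ->
    `|W k.+1 i x - W k i x| <= C * E x / 2 ^+ k.
  elim: k => [|k IH] i x xab; first by rewrite expr0 divr1 CP.
  (* The factor 1/2 arises here: the derivative of the next difference is at most K C E / 2^k, which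
     is the derivative of C E / 2^(k+1) because E' = 2 K E. *)
  rewrite mulrAC; apply: (ac_prim_norm_le (ac_primB (WP k.+1 i) (WP k i))
    (ac_primZ (C / 2 ^+ k.+1) EP)) => //.
  - apply: ae_onT => y /andP[ay yb].
    rewrite /rhs opprD addrACA subrr addr0 -sumrB.
    under eq_bigr do rewrite -mulrBr.
    have yab : a <= y <= b by rewrite !ltW.
    apply: le_trans (MK _ _ _ _ (fun j => IH j y yab)) _.
    rewrite exprS invfM le_eqVlt; apply/orP; left; apply/eqP.
    by field; rewrite expf_neq0.
  - by rewrite !Wa subrr normr0 mulr_ge0 ?(ltW (E0 _))// divr_ge0// exprn_ge0.
have limW (ix : 'I_n * R) : exists l, a <= ix.2 <= b ->
    forall k, `|l - W k ix.1 ix.2| <= 2 * (C * E ix.2) / 2 ^+ k.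
  have [xab|] := boolP (a <= ix.2 <= b); last by exists 0.
  have [||l lP] := @geometric_lim (fun k => W k ix.1 ix.2) (C * E ix.2).
  - by rewrite mulr_ge0// ltW.
  - by move=> k; exact: dW.
  by exists l.
have [V' V'P] := choice limW; pose V i x := V' (i, x).
have VP i x k : a <= x <= b -> `|V i x - W k i x| <= 2 * (C * E x) / 2 ^+ k.
  by move=> xab; exact: (V'P (i, x)).
have small (A : R) e : 0 < e -> 0 <= A -> exists k, A / 2 ^+ k < e.
  move=> e0 A0; exists (Num.truncn (A / e)).
  rewrite ltr_pdivrMr ?exprn_gt0// -ltr_pdivrMl// mulrC.
  have h1 : A / e < (Num.truncn (A / e)).+1%:R.
    by rewrite truncnS_gt.
  apply: lt_le_trans h1 _; rewrite -natrX ler_nat.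
  by rewrite ltn_expl.
have Vok : ok V.
  move=> i; split.
    apply: (@measurable_fun_cvg _ _ _ _ (fun k => W k i)) => [k|x].
      exact: ac_on_measurable.
    rewrite /= in_itv/= => /andP[ax xb]; apply/cvgrPdist_lt => e e0.
    have xab : a <= x <= b by rewrite !ltW.
    have A0 : 0 <= 2 * (C * E x) by rewrite !mulr_ge0// ltW.
    have [k0 k0P] := small _ _ e0 A0.
    exists k0 => // k /= k0k; apply: le_lt_trans (VP _ _ k xab) _.
    apply: le_lt_trans k0P; rewrite ler_wpM2l// lef_pV2 ?posrE ?exprn_gt0//.
    by rewrite ler_eXn2l// ltr1n.
  have [B B0 BP] := ac_on_bounded ab (ac_onZ (2 * C) (proj1 EP)).
  exists (B + `|c i|) => x /andP[ax xb].
  have xab : a <= x <= b by rewrite !ltW.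
  have := VP i x 0%N xab; rewrite expr0 divr1 mulrA => h.
  rewrite -[V i x](subrK (W 0%N i x)); apply: le_trans (ler_normD _ _) _.
  rewrite lerD// (le_trans h)// (le_trans _ (BP _ xab))// ler_norm //.
(* One more integration turns the limit [V] into an absolutely continuous [w]. The two agree on
   [a, b] because both differ from the iterate k+1 by a multiple of E / 2^k. *)
have [w wP] := step Vok; exists w => i.
have wV j x : a <= x <= b -> w j x = V j x.
  move=> xab; apply/eqP; rewrite -subr_eq0 -normr_le0 leNgt; apply/negP => e0.
  have A0 : 0 <= C * E x + 2 * (C * E x) by rewrite addr_ge0// !mulr_ge0// ltW.
  have [k] := small _ _ e0 A0; apply/negP; rewrite -leNgt.
  rewrite -[w j x](subrK (W k.+1 j x)) -addrA.
  apply: le_trans (ler_normD _ _) _; rewrite mulrDl lerD//; last first.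
    rewrite distrC (le_trans (VP _ _ _ xab))// ler_wpM2l ?mulr_ge0 ?(ltW (E0 _))//.
    by rewrite lef_pV2 ?posrE ?exprn_gt0// ler_eXn2l// ltr1n.
  have [wa wP'] := wP j.
  rewrite mulrAC; apply: (ac_prim_norm_le (ac_primB wP' (WP k j))
    (ac_primZ (C / 2 ^+ k) EP)) => //.
  - apply: ae_onT => y /andP[ay yb].
    rewrite /rhs opprD addrACA subrr addr0 -sumrB.
    under eq_bigr do rewrite -mulrBr.
    have yab : a <= y <= b by rewrite !ltW.
    apply: le_trans (MK _ _ _ _ (fun j => VP j y k yab)) _.
    rewrite le_eqVlt; apply/orP; left; apply/eqP.
    by field; rewrite expf_neq0.
  - by rewrite wa Wa subrr normr0 mulr_ge0 ?(ltW (E0 _))// divr_ge0// exprn_ge0.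
have [wa wP'] := wP i; split=> //; apply: ac_prim_ext wP' _.
apply: ae_onT => x /andP[ax xb]; congr (_ + _); apply: eq_bigr => j _.
by rewrite wV// !ltW.
Qed.

End LinearSystem.

(** * Borel representatives and square-integrable functions *)

Section BorelRepresentative.
Context (R : realType).
Implicit Types (a b : R) (f g h r : R -> R).
Local Notation mu := (@lebesgue_measure R).
Local Notation cmu := (@completed_lebesgue_measure R).

(** The Caratheodory sigma-algebra is the completion of the Borel one: its members are Borel sets
    enlarged by subsets of Borel null sets. *)
Lemma lebesgue_measurable_Borel (E : set R) :
  measurable (E : set (lebesgueT R)) ->
  exists A B : set R, [/\ measurable A, measurable B, mu B = 0%E,
    A `<=` E & E `<=` A `|` B].
Proof.
move=> mE.
have : ((wlength idfun)^*%mu).-cara.-measurable E by exact: mE.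
rewrite -completed_caratheodory_measurable g_sigma_completed_algebra_genE.
move=> [A mA [N [B [mB B0 NB]]]] <-.
by exists A, B; split => // x [Ax|Nx]; [left|right; exact: NB].
Qed.

Lemma measurable_id_lebesgueT :
  measurable_fun setT (fun x : lebesgueT R => x : R).
Proof. by move=> _ A mA; rewrite setTI; exact: sub_caratheodory. Qed.

Lemma lebesgue_L1_Borel a b r : lebesgue_L1 `]a, b[ r ->
  exists g, L1_on a b g /\ ae_on a b (fun x => r x = g x).
Proof.
move=> ir; have mI : measurable (`]a, b[%classic : set R) by exact: measurable_itv.
have mIc : measurable (`]a, b[%classic : set (lebesgueT R)).
  exact: sub_caratheodory.
have mr : measurable_fun (`]a, b[%classic : set (lebesgueT R)) (r : lebesgueT R -> R).
  by apply/measurable_EFinP; exact: (measurable_int cmu ir).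
(* An enumeration of the rationals; a number that encodes none gives 0, which only repeats a
   level. *)
pose q n : R := ratr (odflt 0%Q (unpickle n)).
pose E n : set R := `]a, b[ `&` [set x | q n < r x].
have mE n : measurable (E n : set (lebesgueT R)).
  rewrite /E (_ : [set x | q n < r x] = r @^-1` `]q n, +oo[%classic).
    exact: mr.
  by apply/seteqP; split => x /=; rewrite in_itv/= andbT.
pose AB := fun n => cid (lebesgue_measurable_Borel (mE n)).
pose A n := sval (AB n); pose B n := sval (cid (svalP (AB n))).
have ABP n : [/\ measurable (A n), measurable (B n), mu (B n) = 0%E,
    A n `<=` E n & E n `<=` A n `|` B n].
  exact: (svalP (cid (svalP (AB n)))).
have [N [mN N0 BN]] : mu.-negligible (\bigcup_n B n).
  apply: (@negligible_bigcup _ _ _ mu) => n; exists (B n).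
  by have [] := ABP n; split.
(* Outside [N] every superlevel set of [r] at a rational level coincides with the Borel set [A n],
   so [r] is Borel measurable on [D]. *)
pose D : set R := `]a, b[ `\` N.
have mD : measurable D by exact: measurableD.
have mrD : measurable_fun D r.
  apply: (measurability _ (RGenOInfty.measurableE R)) => //.
  move=> _ [_ [y ->] <-].
  rewrite (_ : _ `&` _ = \bigcup_(n in [set n | y <= q n]) (A n `\` N)).
    apply: bigcup_measurable => n _; apply: measurableD => //.
    by have [] := ABP n.
  apply/seteqP; split => x /=.
    move=> [[xab Nx]]; rewrite in_itv/= andbT => yrx.
    have [z] := rat_in_itvoo yrx; rewrite in_itv/= => /andP[yz zr].
    have qz : q (pickle z) = ratr z by rewrite /q pickleK.
    exists (pickle z) => /=; first by rewrite qz ltW.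
    split=> //; have [_ _ _ _ EAB] := ABP (pickle z).
    have [//|Bx] : (A (pickle z) `|` B (pickle z)) x.
      by apply: EAB; split => //=; rewrite qz.
    by exfalso; apply: Nx; apply: BN; exists (pickle z).
  move=> [n /= yq [Ax Nx]]; have [_ _ _ AE _] := ABP n.
  have [xab /= qr] := AE _ Ax; split; first by split.
  by rewrite in_itv/= andbT (le_lt_trans yq).
pose g := r \_ D.
have mg : measurable_fun setT g by exact: (measurable_restrictT r mD).1 mrD.
exists g; split; last first.
  exists N; split => // x /= rg; apply: contrapT => Nx; apply: rg => xab.
  by rewrite /g patchE mem_set//; split => //=; rewrite in_itv/=.
have mgI : measurable_fun `]a, b[ (EFin \o g).
  by apply/measurable_EFinP; exact: measurable_funTS.
have mag : measurable_fun setT (fun y => (`|g y|)%:E).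
  by apply/measurable_EFinP; exact: measurableT_comp.
apply/integrableP; split => //.
(* The identity pushes the completed measure forward to Lebesgue measure on Borel sets, so the
   integral of |g| can be compared with that of |r| on the completed side. *)
pose psi : lebesgueT R -> measurableTypeR R := id.
have mpsi : measurable_fun setT psi by exact: measurable_id_lebesgueT.
pose mfun_psi := isMeasurableFun.Build _ _ _ _ _ mpsi.
pose psi' : {mfun lebesgueT R >-> measurableTypeR R} := HB.pack psi mfun_psi.
rewrite (@eq_measure_integral _ _ _ _ (pushforward cmu psi'))//.
rewrite (ge0_integral_pushforward mpsi)//; last first.
  exact: measurable_funTS.
move/integrableP : ir => [mir]; apply: le_lt_trans.
apply: ge0_le_integral.
- exact: mIc.
- by move=> x _ /=; rewrite lee_fin.
- exact: (measurable_funTS (measurableT_comp mag mpsi)).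
- exact: measurableT_comp.
- move=> x _ /=; rewrite lee_fin /g patchE; case: ifPn => // _.
  by rewrite normr0.
Qed.

End BorelRepresentative.

Section L2Interval.
Context (R : realType) (a b : R).
Local Notation mu := (@lebesgue_measure R).
Local Notation muab := (mrestr mu (measurable_itv `]a, b[)).
Implicit Types (u v : L2J a b).

Lemma ge0_integral_mrestr_itv (f : R -> \bar R) : measurable_fun setT f ->
  (forall x, 0 <= f x)%E ->
  (\int[muab]_x f x = \int[mu]_(x in `]a, b[) f x)%E.
Proof.
move=> mf f0; have mI : measurable (`]a, b[%classic : set R) by exact: measurable_itv.
rewrite -(setUv `]a, b[%classic) ge0_integral_setU//; last 3 first.
- exact: measurableC.
- exact: measurable_funTS.
- by rewrite /disj_set setICr.
rewrite [X in (_ + X)%E](@null_set_integral _ _ _ muab)//; last 3 first.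
- exact: measurableC.
- exact: measurable_funTS.
- by rewrite /= /mrestr setICl measure0.
rewrite adde0; apply: eq_measure_integral => A mA AI.
by rewrite /= /mrestr setIidl.
Qed.

Lemma ae_mrestr_itvP (P : R -> Prop) : {ae muab, forall x, P x} <-> ae_on a b P.
Proof.
have mI : measurable (`]a, b[%classic : set R) by exact: measurable_itv.
split=> [[N [mN N0 PN]]|[N [mN N0 PN]]].
  exists (N `&` `]a, b[); split => //; first exact: measurableI.
  move=> x /= nP; have xab : a < x < b by apply: contrapT => nx; apply: nP.
  by split; [apply: PN => Px; apply: nP|rewrite /= in_itv].
exists (N `|` ~` `]a, b[); split.
- by apply: measurableU => //; exact: measurableC.
- rewrite /= /mrestr setIUl setICl setU0.
  apply/eqP; rewrite eq_le measure_ge0 andbT -N0.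
  by apply: le_measure; rewrite ?inE//; exact: measurableI.
- move=> x /= nP; have [xab|xab] := pselect (`]a, b[%classic x); last by right.
  left; apply: PN => /= h; apply: nP; apply: h.
  by move: xab; rewrite /= in_itv.
Qed.

Lemma L2_funD u v : ae_on a b (fun x => cL2_fun (u + v) x = u x + v x).
Proof. by apply/ae_mrestr_itvP; exact: cL2_funD. Qed.

Lemma L2_funZ k u : ae_on a b (fun x => cL2_fun (k *: u) x = k * u x).
Proof. by apply/ae_mrestr_itvP; exact: cL2_funZ. Qed.

Lemma L2_fun0 : ae_on a b (fun x => cL2_fun (0 : L2J a b) x = 0).
Proof.
have := L2_funZ 0 0; rewrite scale0r => h.
by apply: ae_onS h _ => x _ ->; rewrite mul0r.
Qed.

Lemma L2_measurable u : cmeasurable u.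
Proof. exact: sqfun_measurable (repr u). Qed.

Definition L2sq u : R := \int[mu]_(x in `]a, b[) normc (u x) ^+ 2.

Lemma L2_integral_fin u :
  (\int[mu]_(x in `]a, b[) (normc (u x) ^+ 2)%:E < +oo)%E.
Proof.
have mn2 : measurable_fun setT (fun x => (normc (u x) ^+ 2)%:E).
  apply/measurable_EFinP; apply: measurable_funX.
  exact/measurable_normc/L2_measurable.
have := sqfun_finite (repr u); rewrite eL2normE ge0_integral_mrestr_itv//; last first.
  by move=> x; rewrite lee_fin sqr_ge0.
set I := (X in (X `^ _)%E); change (\int[mu]_(x in `]a, b[) _)%E with I.
by rewrite !ltey; apply: contra_neq => ->; rewrite poweRyr// invr_neq0.
Qed.

Lemma L2sq_L1 u : L1_on a b (fun x => normc (u x) ^+ 2).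
Proof.
apply/integrableP; split.
  apply/measurable_EFinP; apply: measurable_funTS; apply: measurable_funX.
  exact/measurable_normc/L2_measurable.
under eq_integral do rewrite /= ger0_norm ?sqr_ge0//.
exact: L2_integral_fin.
Qed.

Lemma L2sq_ge0 u : 0 <= L2sq u.
Proof. by apply: Rintegral_ge0 => x _; exact: sqr_ge0. Qed.

Lemma L2_normE u : `|u| = (Num.sqrt (L2sq u))%:C.
Proof.
have mn2 : measurable_fun setT (fun x => (normc (u x) ^+ 2)%:E).
  apply/measurable_EFinP; apply: measurable_funX.
  exact/measurable_normc/L2_measurable.
rewrite [LHS]/(cL2_norm _) /cL2_norm eL2normE ge0_integral_mrestr_itv//; last first.
  by move=> x; rewrite lee_fin sqr_ge0.
have -> : (\int[mu]_(x in `]a, b[) (normc (u x) ^+ 2)%:E = (L2sq u)%:E)%E.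
  rewrite /L2sq /Rintegral fineK// ge0_fin_numE ?L2_integral_fin//.
  by apply: integral_ge0 => x _; rewrite lee_fin sqr_ge0.
by rewrite poweR_EFin powR12_sqrt ?L2sq_ge0.
Qed.

Lemma L1_on_cst (c : R) : L1_on a b (fun=> c).
Proof.
apply: measurable_bounded_integrable => //.
  by rewrite /= lebesgue_measure_itv/=; case: ifPn => // _; rewrite -EFinD ltry.
by exists `|c|; split; [exact: num_real|move=> M /ltW cM x _].
Qed.

(** On a finite interval constants are integrable, and |x| <= 1 + |x|^2. *)
Lemma L2_ReIm_L1 u : L1_on a b (fun x => complex.Re (u x)) /\
  L1_on a b (fun x => complex.Im (u x)).
Proof.
have [mr mi] := L2_measurable u.
have i1 : L1_on a b (fun x => 1 + normc (u x) ^+ 2).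
  by apply: L1_onD; [exact: L1_on_cst|exact: L2sq_L1].
have le1 (x y : R) : `|x| <= y -> `|x| <= `|1 + y ^+ 2|.
  move=> xy; rewrite (le_trans xy)// (le_trans _ (ler_norm _))//.
  have := sqr_ge0 (y - 1); have := sqr_ge0 y; nra.
split; [apply: L1_on_le i1 _ => [|x _]; [exact: measurable_funTS|]..].
  by apply: le1; have [] := normc_ge_ReIm (u x).
by apply: le1; have [] := normc_ge_ReIm (u x).
Qed.

(** Composition with [clamp] gives a representative that is continuous and bounded on the whole
    line. *)
Lemma L2_of_ac (y1 y2 : R -> R) : a <= b -> ac_on a b y1 -> ac_on a b y2 ->
  exists u, ae_on a b (fun x => u x = y1 x +i* y2 x).
Proof.
move=> ab ac1 ac2; pose y x := y1 (clamp a b x) +i* y2 (clamp a b x).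
have my : cmeasurable y.
  by split; apply: continuous_measurable_fun; exact: ac_on_clamp_continuous.
have [M1 M10 M1P] := ac_on_bounded ab ac1; have [M2 M20 M2P] := ac_on_bounded ab ac2.
have iy : L1_on a b (fun x => normc (y x) ^+ 2).
  apply: L1_on_le (L1_on_cst ((M1 + M2) ^+ 2)) _ => [|x _].
    by apply: measurable_funTS; apply: measurable_funX; exact: measurable_normc.
  rewrite !ger0_norm ?sqr_ge0// lerXn2r ?nnegrE ?normc_ge0 ?addr_ge0//.
  apply: le_trans (normc_le_ReIm _) _.
  by rewrite lerD ?M1P ?M2P// clamp_itv.
have ysq : y \in sqint muab.
  rewrite inE; split=> //; rewrite eL2normE ge0_integral_mrestr_itv; last first.
  - by move=> x; rewrite lee_fin sqr_ge0.
  - apply/measurable_EFinP; apply: measurable_funX; exact: measurable_normc.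
  have If : (\int[mu]_(x in `]a, b[) (normc (y x) ^+ 2)%:E \is a fin_num)%E.
    by apply: integrable_fin_num => //; exact: measurable_itv.
  by rewrite -(fineK If) poweR_EFin ltry.
exists (\pi_(cL2 muab) (SqFun ysq))%qT.
have /ae_mrestr_itvP aey := repr_cL2K (SqFun ysq).
apply: ae_onS aey _ => x /andP[ax xb] ->.
by rewrite [LHS]/(y x) /y clampE// !ltW.
Qed.

End L2Interval.

(** * Linear relations in finite dimension *)

Section LinearRelations.

(** A selection on the standard basis extends to a linear map whose graph lies in the relation. *)
Lemma lin_rel_sum (F : fieldType) (V : lmodType F) (n : nat)
    (S : 'cV[F]_n -> V -> Prop) :
  (forall k c d h g, S c h -> S d g -> S (k *: c + d) (k *: h + g)) ->
  S 0 0 -> forall g : 'I_n -> V, (forall i, S (delta_mx i 0) (g i)) ->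
  forall c, S c (\sum_i c i 0 *: g i).
Proof.
move=> Slin S0 g Sg c; have {1}-> : c = \sum_i c i 0 *: delta_mx i 0.
  rewrite [LHS]matrix_sum_delta; apply: eq_bigr => i _.
  by rewrite big_ord1.
elim: (index_enum _) => [|i l IH]; first by rewrite !big_nil.
by rewrite !big_cons; exact: Slin.
Qed.

(** A linear selection is a square matrix; triviality of the preimages of 0 makes it injective,
    hence invertible. Working with relations avoids having to choose solutions linearly in their
    data. *)
Lemma lin_rel_surj (F : fieldType) (n : nat) (S : 'cV[F]_n -> 'cV[F]_n -> Prop) :
  (forall k c d c' d', S c c' -> S d d' -> S (k *: c + d) (k *: c' + d')) ->
  (forall c, exists c', S c c') -> (forall c, S c 0 -> c = 0) ->
  forall c', exists c, S c c'.
Proof.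
move=> Slin Stot Sinj.
have S0 : S 0 0.
  have [c' Sc] := Stot 0; have := Slin (-1) _ _ _ _ Sc Sc.
  by rewrite !scaleN1r !addNr.
have [g Sg] := choice (fun i : 'I_n => Stot (delta_mx i 0)).
have SA := lin_rel_sum Slin S0 Sg.
pose A := \matrix_(i, j) g j i 0 : 'M[F]_n.
have AE (c : 'cV[F]_n) : \sum_i c i 0 *: g i = A *m c.
  apply/colP => i; rewrite summxE !mxE; apply: eq_bigr => j _.
  by rewrite !mxE mulrC.
have Aker : kermx A^T = 0.
  apply/row_matrixP => i; rewrite row0; set v := row i _.
  have vA : v *m A^T = 0 by rewrite -row_mul mulmx_ker row0.
  have Av : A *m v^T = 0 by apply: trmx_inj; rewrite trmx_mul trmxK trmx0.
  have := SA v^T; rewrite AE Av => /Sinj /(congr1 trmx).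
  by rewrite trmxK trmx0.
have Au : A \in unitmx.
  rewrite -unitmx_tr -row_free_unit -kermx_eq0 Aker; exact/eqP.
move=> c'; exists (invmx A *m c'); rewrite -[X in S _ X](mulKVmx Au) -AE.
exact: SA.
Qed.

End LinearRelations.

Section Vec4.
Context (F : fieldType).
Implicit Types c d : F.

Definition vec4 (c0 c1 c2 c3 : F) : 'cV[F]_4 :=
  \col_(i < 4) nth 0 [:: c0; c1; c2; c3] i.

Lemma vec4_surj (v : 'cV[F]_4) : exists c0 c1 c2 c3, v = vec4 c0 c1 c2 c3.
Proof.
exists (v 0 0), (v 1 0), (v 2%:R 0), (v 3%:R 0); apply/colP => i.
by rewrite mxE; case: i => [[|[|[|[|//]]]] ?] /=; congr (v _ _); apply: val_inj.
Qed.

Lemma vec4_inj c0 c1 c2 c3 d0 d1 d2 d3 : vec4 c0 c1 c2 c3 = vec4 d0 d1 d2 d3 ->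
  [/\ c0 = d0, c1 = d1, c2 = d2 & c3 = d3].
Proof.
move=> /colP vv; have h (i : 'I_4) := vv i.
by split; [have := h 0|have := h 1|have := h 2%:R|have := h 3%:R]; rewrite !mxE.
Qed.

Lemma vec4_lin k c0 c1 c2 c3 d0 d1 d2 d3 :
  k *: vec4 c0 c1 c2 c3 + vec4 d0 d1 d2 d3 =
  vec4 (k * c0 + d0) (k * c1 + d1) (k * c2 + d2) (k * c3 + d3).
Proof.
by apply/colP => i; rewrite !mxE; case: i => [[|[|[|[|//]]]] ?].
Qed.

Lemma vec4_0 : vec4 0 0 0 0 = 0.
Proof. by apply/colP => i; rewrite !mxE; case: i => [[|[|[|[|//]]]] ?]. Qed.

End Vec4.

Section AlmostEverywhere.
Context (R : realType).
Implicit Types (a b : R) (f g : R -> R).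
Local Notation mu := (@lebesgue_measure R).

Lemma ae_on_exists a b c d (P : R -> Prop) : ae_on a b P -> a <= c -> c < d ->
  d <= b -> exists x, c < x < d /\ P x.
Proof.
move=> [N [mN N0 PN]] ac cd db; apply: contrapT => nex.
have cdN : `]c, d[ `<=` N.
  move=> x; rewrite /= in_itv/= => xcd; apply: PN => /= Px; apply: nex.
  exists x; split=> //; apply: Px; move/andP: xcd => [cx xd].
  by rewrite (le_lt_trans ac)//= (lt_le_trans xd).
have : (mu `]c, d[ <= mu N)%E.
  by apply: le_measure; rewrite ?inE//; exact: measurable_itv.
by rewrite N0 lebesgue_measure_itv/= lte_fin cd -EFinD lee_fin; lra.
Qed.

Lemma ac_on_ae0 a b f : a < b -> ac_on a b f -> ae_on a b (fun x => f x = 0) ->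
  forall x, a <= x <= b -> f x = 0.
Proof.
move=> ab fa f0 x xab; apply/eqP/negPn/negP; rewrite -normr_gt0 => e0.
have [d d0 fd] := ac_on_unif fa e0.
have [ax xb] := andP xab.
have [y [yab fy]] : exists y, (a <= y <= b /\ `|x - y| < d) /\ f y = 0.
  pose c := Num.max a (x - d); pose e := Num.min b (x + d).
  have ce : c < e by rewrite lt_min !gt_max; apply/andP; split; apply/andP; split; lra.
  have ac : a <= c by rewrite le_max lexx.
  have eb : e <= b by rewrite ge_min lexx.
  have [y [/andP[cy ye] fy]] := ae_on_exists f0 ac ce eb.
  exists y; split=> //; have [xc ex] : x - d <= c /\ e <= x + d.
    by rewrite le_max ge_min !lexx !orbT.
  split; first by apply/andP; split; lra.
  by rewrite ltr_norml; apply/andP; split; lra.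
have := fd x y xab yab.1 yab.2; rewrite fy subr0 ltxx //.
Qed.

Lemma ac_prim_eq0 a b f g : a < b -> ac_prim a b f g ->
  (forall x, a <= x <= b -> f x = 0) -> ae_on a b (fun x => g x = 0).
Proof.
move=> ab [fa fg] f0; apply: ae_onS fg _ => x xab d.
have : is_derive x (1 : R) f 0.
  apply: (@near_eq_is_derive _ _ _ (cst 0)).
  have xab' : x \in `]a, b[ by rewrite in_itv.
  have := near_in_itvoo xab'; apply: filterS => y.
  by rewrite in_itv/= => /andP[ay yb]; rewrite /cst f0// !ltW.
by move=> d'; rewrite -(@derive_val _ _ _ _ _ _ _ d) (@derive_val _ _ _ _ _ _ _ d').
Qed.

End AlmostEverywhere.

(** * Solutions of (l - lam) y = f and their boundary values *)

Section RealSystem.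
Context (R : realType).
Variables (a b : R) (ab : a < b) (r s t : R -> R).
Hypotheses (ir : L1_on a b r) (is_ : L1_on a b s) (it : L1_on a b t).
Implicit Types (f h u : L2J a b) (y z e g : R -> R).
Local Notation mu := (@lebesgue_measure R).
Let leab : a <= b. Proof. exact: ltW. Qed.

(* Real and imaginary parts of y' = r z + s y, z' = - s z - t y - lam y - f with
   lam = l1 + i l2, that is, of (l - lam) y = f with z = D^[1] y. *)
Definition SLsys (l1 l2 : R) f y1 y2 z1 z2 : Prop :=
  [/\ ac_prim a b y1 (fun x => r x * z1 x + s x * y1 x),
      ac_prim a b y2 (fun x => r x * z2 x + s x * y2 x),
      ac_prim a b z1 (fun x => - (s x * z1 x) - t x * y1 x -
        (l1 * y1 x - l2 * y2 x) - complex.Re (f x)) &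
      ac_prim a b z2 (fun x => - (s x * z2 x) - t x * y2 x -
        (l1 * y2 x + l2 * y1 x) - complex.Im (f x))].

Lemma sqr_normc (z : R[i]) : normc z ^+ 2 = complex.Re z ^+ 2 + complex.Im z ^+ 2.
Proof. by case: z => x y /=; rewrite sqr_sqrtr// addr_ge0// sqr_ge0. Qed.

Lemma SLsys_lin l1 l2 (k1 k2 : R) f f' y1 y2 z1 z2 y1' y2' z1' z2' :
  SLsys l1 l2 f y1 y2 z1 z2 -> SLsys l1 l2 f' y1' y2' z1' z2' ->
  SLsys l1 l2 ((k1 +i* k2) *: f + f')
    (fun x => k1 * y1 x - k2 * y2 x + y1' x)
    (fun x => k1 * y2 x + k2 * y1 x + y2' x)
    (fun x => k1 * z1 x - k2 * z2 x + z1' x)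
    (fun x => k1 * z2 x + k2 * z1 x + z2' x).
Proof.
move=> [Y1 Y2 Z1 Z2] [Y1' Y2' Z1' Z2'].
have fE := ae_onI (L2_funD ((k1 +i* k2) *: f) f') (L2_funZ (k1 +i* k2) f).
split.
- apply: ac_prim_ext (ac_primD (ac_primB (ac_primZ k1 Y1) (ac_primZ k2 Y2)) Y1') _.
  by apply: ae_onT => x _; ring.
- apply: ac_prim_ext (ac_primD (ac_primD (ac_primZ k1 Y2) (ac_primZ k2 Y1)) Y2') _.
  by apply: ae_onT => x _; ring.
- apply: ac_prim_ext (ac_primD (ac_primB (ac_primZ k1 Z1) (ac_primZ k2 Z2)) Z1') _.
  apply: ae_onS fE _ => x _ [-> ->].
  by case: (cL2_fun f x) (cL2_fun f' x) => [? ?] [? ?] /=; ring.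
- apply: ac_prim_ext (ac_primD (ac_primD (ac_primZ k1 Z2) (ac_primZ k2 Z1)) Z2') _.
  apply: ae_onS fE _ => x _ [-> ->].
  by case: (cL2_fun f x) (cL2_fun f' x) => [? ?] [? ?] /=; ring.
Qed.

Lemma SLsys_exists l1 l2 f (c0 c1 c2 c3 : R) : exists y1 y2 z1 z2,
  SLsys l1 l2 f y1 y2 z1 z2 /\
  [/\ y1 a = c0, y2 a = c1, z1 a = c2 & z2 a = c3].
Proof.
have [if1 if2] := L2_ReIm_L1 f.
have iN g : L1_on a b g -> L1_on a b (fun x => - g x).
  move=> ig; apply: L1_on_le (ig) _ => [|x _]; last by rewrite normrN.
  by apply: measurable_funN; exact: L1_on_measurable.
pose cst0 : R -> R := fun=> 0.
(* Rows and columns are in the order y1, y2, z1, z2. *)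
pose M (i j : 'I_4) : R -> R := nth cst0 (nth [::]
  [:: [:: s; cst0; r; cst0]; [:: cst0; s; cst0; r];
      [:: (fun x => - t x - l1); (fun=> l2); (fun x => - s x); cst0];
      [:: (fun=> - l2); (fun x => - t x - l1); cst0; (fun x => - s x)]] i) j.
pose F (i : 'I_4) : R -> R := nth cst0
  [:: cst0; cst0; (fun x => - complex.Re (f x)); (fun x => - complex.Im (f x))] i.
have iM i j : L1_on a b (M i j).
  have i0 := L1_on_cst a b.
  by rewrite /M; case: i j => [[|[|[|[|//]]]] ?] [[|[|[|[|//]]]] ?] /=;
    try exact: i0; try exact: iN; rewrite //; apply: L1_onD; try exact: i0;
    exact: iN.
have iF i : L1_on a b (F i).
  have i0 := L1_on_cst a b.
  by rewrite /F; case: i => [[|[|[|[|//]]]] ?] /=; try exact: i0; exact: iN.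
have [w wP] := linear_system_exists leab (fun i : 'I_4 => [:: c0; c1; c2; c3]`_i) iM iF.
exists (w 0), (w 1), (w 2%:R), (w 3%:R).
have lift1 : lift ord0 (ord0 : 'I_3) = 1 :> 'I_4 by exact: val_inj.
have lift2 : lift ord0 (lift ord0 (ord0 : 'I_2)) = 2%:R :> 'I_4 by exact: val_inj.
have lift3 : lift ord0 (lift ord0 (lift ord0 (ord0 : 'I_1))) = 3%:R :> 'I_4.
  exact: val_inj.
have [w0 W0] := wP 0; have [w1 W1] := wP 1; have [w2 W2] := wP 2%:R.
have [w3 W3] := wP 3%:R.
split; last by split.
split; [apply: ac_prim_ext W0 _|apply: ac_prim_ext W1 _|
  apply: ac_prim_ext W2 _|apply: ac_prim_ext W3 _]; apply: ae_onT => x _;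
  rewrite !big_ord_recl big_ord0 lift1 lift2 lift3 /M /F /cst0 /=; ring.
Qed.

(** With m = - l2, the derivative of Im(z conj(y)) = z2 y1 - z1 y2 is m |y|^2 - Im(f conj(y)), the
    terms with r, s, t and l1 cancelling. Completing the square absorbs the mixed term into m |y|^2
    / 2 + |f|^2 / (2 m). *)
Lemma SLsys_energy l1 l2 f u y1 y2 z1 z2 : l2 < 0 ->
  SLsys l1 l2 f y1 y2 z1 z2 -> ae_on a b (fun x => u x = y1 x +i* y2 x) ->
  - l2 / 2 * L2sq u - (- l2 * 2)^-1 * L2sq f <=
  (z2 b * y1 b - z1 b * y2 b) - (z2 a * y1 a - z1 a * y2 a).
Proof.
move=> l20 [Y1 Y2 Z1 Z2] uy; pose m := - l2; have m0 : 0 < m by rewrite /m oppr_gt0.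
have [U [Ua UP Ub]] := ac_prim_exists leab (L2sq_L1 u).
have [G [Ga GP Gb]] := ac_prim_exists leab (L2sq_L1 f).
have P1 := ac_primB (ac_primM leab Z2 Y1) (ac_primM leab Z1 Y2).
have P2 := ac_primB (ac_primZ (m / 2) UP) (ac_primZ (m * 2)^-1 GP).
have := ac_prim_le P2 P1 _ (lexx a) leab (lexx b).
rewrite Ua Ga !mulr0 !subr0 Ub Gb; apply; apply: ae_onS uy _ => x _ uE.
rewrite !sqr_normc uE /=.
set f1 := complex.Re _; set f2 := complex.Im _.
rewrite -subr_ge0 [leRHS](_ : _ =
  (m * 2)^-1 * ((m * y1 x - f2) ^+ 2 + (m * y2 x + f1) ^+ 2)); last first.
  by rewrite /m; field; rewrite lt_eqF.
by rewrite mulr_ge0 ?addr_ge0 ?sqr_ge0// invr_ge0 mulr_ge0 ?ltW.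
Qed.

(** [L] is Re(z g - y e), without conjugation, so that both solutions belong to the same lam. Its
    derivative is Re(y h), bounded by Young's inequality with weight [eps]. *)
Lemma SLsys_lagrange l1 l2 u h y1 y2 z1 z2 g1 g2 e1 e2 (eps : R) : 0 < eps ->
  SLsys l1 l2 0 y1 y2 z1 z2 -> ae_on a b (fun x => u x = y1 x +i* y2 x) ->
  SLsys l1 l2 h g1 g2 e1 e2 ->
  let L x := z1 x * g1 x - z2 x * g2 x - (y1 x * e1 x - y2 x * e2 x) in
  L b - L a <= eps / 2 * L2sq h + (eps * 2)^-1 * L2sq u.
Proof.
move=> eps0 [Y1 Y2 Z1 Z2] uy [G1 G2 E1 E2] /=.
have [U [Ua UP Ub]] := ac_prim_exists leab (L2sq_L1 u).
have [H [Ha HP Hb]] := ac_prim_exists leab (L2sq_L1 h).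
have P1 := ac_primB (ac_primB (ac_primM leab Z1 G1) (ac_primM leab Z2 G2))
  (ac_primB (ac_primM leab Y1 E1) (ac_primM leab Y2 E2)).
have P2 := ac_primD (ac_primZ (eps / 2) HP) (ac_primZ (eps * 2)^-1 UP).
have := ac_prim_le P1 P2 _ (lexx a) leab (lexx b).
rewrite Ua Ha !mulr0 !addr0 !subr0 Ub Hb; apply.
have f0 := L2_fun0 a b.
apply: ae_onS (ae_onI uy f0) _ => x _ [uE f0E].
rewrite !sqr_normc uE f0E /=.
set h1 := complex.Re _; set h2 := complex.Im _.
rewrite -subr_ge0 [leRHS](_ : _ =
  (eps * 2)^-1 * ((eps * h1 - y1 x) ^+ 2 + (eps * h2 + y2 x) ^+ 2)); last first.
  by field; rewrite gt_eqF.
by rewrite mulr_ge0 ?addr_ge0 ?sqr_ge0// invr_ge0 mulr_ge0 ?ltW.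
Qed.

(** Here k solves the homogeneous equation for the conjugate of lam and also drives y. In the
    derivative of T = Re(y conj(e) - z conj(k)) everything cancels except |k|^2. *)
Lemma SLsys_adjoint l1 l2 (k : L2J a b) k1 k2 e1 e2 y1 y2 z1 z2 :
  SLsys l1 (- l2) 0 k1 k2 e1 e2 -> ae_on a b (fun x => k x = k1 x +i* k2 x) ->
  SLsys l1 l2 k y1 y2 z1 z2 ->
  let T x := y1 x * e1 x + y2 x * e2 x - (z1 x * k1 x + z2 x * k2 x) in
  T b - T a = L2sq k.
Proof.
move=> [K1 K2 E1 E2] kE [Y1 Y2 Z1 Z2] T.
have [U [Ua UP Ub]] := ac_prim_exists leab (L2sq_L1 k).
have P1 := ac_primB (ac_primD (ac_primM leab Y1 E1) (ac_primM leab Y2 E2))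
  (ac_primD (ac_primM leab Z1 K1) (ac_primM leab Z2 K2)).
have f0 := L2_fun0 a b.
have P2 : ac_prim a b T (fun x => normc (k x) ^+ 2).
  apply: ac_prim_ext P1 _; apply: ae_onS (ae_onI kE f0) _ => x _ [kx f0x].
  by rewrite sqr_normc kx f0x /=; ring.
have -> : L2sq k = U b - U a by rewrite Ua subr0 Ub.
(* [T] and [U] have the same derivative; comparison in both directions equates their increments. *)
apply/eqP; rewrite eq_le.
have le1 : ae_on a b (fun x => normc (k x) ^+ 2 <= normc (k x) ^+ 2).
  exact: ae_onT.
by rewrite (ac_prim_le UP P2 le1)// (ac_prim_le P2 UP le1).
Qed.

(** If k vanishes identically, its equation reduces to r e = 0 almost everywhere, so e = 0 almost
    everywhere and by continuity everywhere. *)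
Lemma SLsys_unique0 l1 l2 k1 k2 e1 e2 : ae_on a b (fun x => r x != 0) ->
  SLsys l1 l2 0 k1 k2 e1 e2 -> ae_on a b (fun x => 0 = k1 x +i* k2 x) ->
  [/\ k1 a = 0, k2 a = 0, e1 a = 0 & e2 a = 0].
Proof.
move=> r0 [K1 K2 E1 E2] kE.
have aab : a <= a <= b by rewrite lexx.
have k10 : forall x, a <= x <= b -> k1 x = 0.
  by apply: (ac_on_ae0 ab (proj1 K1)); apply: ae_onS kE _ => x _ [].
have k20 : forall x, a <= x <= b -> k2 x = 0.
  by apply: (ac_on_ae0 ab (proj1 K2)); apply: ae_onS kE _ => x _ [].
have e0 (k e : R -> R) : ac_prim a b k (fun x => r x * e x + s x * k x) -> ac_on a b e ->
    (forall x, a <= x <= b -> k x = 0) -> e a = 0.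
  move=> kP ea k0; apply: (ac_on_ae0 ab ea _ aab).
  apply: ae_onS (ae_onI r0 (ac_prim_eq0 ab kP k0)) _ => x /andP[ax xb] [rx].
  rewrite k0 ?ltW// mulr0 addr0 => /eqP; rewrite mulf_eq0 (negbTE rx) => /eqP //.
split; [exact: k10|exact: k20|exact: e0 K1 (proj1 E1) k10|].
exact: e0 K2 (proj1 E2) k20.
Qed.

End RealSystem.

Section RealNorm.
Context (R : realType) (V : normedModType R[i]).
Implicit Types x y : V.

(** Norms take values in R[i]; the real part keeps the estimates in the ordered field R. *)
Definition rnorm x : R := complex.Re `|x|.

Lemma rnormE x : `|x| = (rnorm x)%:C.
Proof. by rewrite /rnorm ge0_ReK. Qed.

Lemma rnorm_ge0 x : 0 <= rnorm x.
Proof. exact: (le_Re (normr_ge0 x)). Qed.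

Lemma rnormD x y : rnorm (x + y) <= rnorm x + rnorm y.
Proof. by have := le_Re (ler_normD x y); rewrite (rnormE x) (rnormE y). Qed.

Lemma rnormZ k x : rnorm (k *: x) = normc k * rnorm x.
Proof.
by rewrite {1}/rnorm normrZ norm_normc rnormE /= mul0r subr0.
Qed.

Lemma rnormN x : rnorm (- x) = rnorm x.
Proof. by rewrite /rnorm normrN. Qed.

Lemma rnorm0 : rnorm 0 = 0.
Proof. by rewrite /rnorm normr0. Qed.

Lemma rnorm_eq0 x : rnorm x = 0 -> x = 0.
Proof. by move=> x0; apply/eqP; rewrite -normr_eq0 rnormE x0 eqxx. Qed.

End RealNorm.

(** * The relation between right-hand sides, solutions and boundary vectors *)

Section Rel.
Context (R : realType).
Variables (a b : R) (ab : a < b) (r s t : R -> R).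
Hypotheses (ir : L1_on a b r) (is_ : L1_on a b s) (it : L1_on a b t).
Variables (l1 l2 : R).
Implicit Types (f h u : L2J a b) (y z e g : R -> R[i]) (v w : hermC2 R).
Local Notation i := (0 +i* 1 : R[i]).
Local Notation SL := (SLsys r s t l1 l2).

Lemma sqr_rnorm_L2 u : rnorm u ^+ 2 = L2sq u.
Proof. by rewrite /rnorm L2_normE /= sqr_sqrtr// L2sq_ge0. Qed.

Lemma sqr_rnorm_herm v :
  rnorm v ^+ 2 = normc (v 0 0) ^+ 2 + normc (v 1 0) ^+ 2.
Proof.
have -> : rnorm v = Num.sqrt (normc (v 0 0) ^+ 2 + normc (v 1 0) ^+ 2).
  rewrite [LHS]/(complex.Re (herm_norm v)) /herm_norm /=.
  by rewrite !big_ord_recl big_ord0 addr0; 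
  congr (Num.sqrt (_ + normc (v _ _) ^+ 2)); exact: val_inj.
by rewrite sqr_sqrtr// addr_ge0// sqr_ge0.
Qed.

Lemma normc_le_rnorm v j : normc (v j 0) <= rnorm v.
Proof.
rewrite -(@ler_pXn2r _ 2) ?nnegrE ?normc_ge0 ?rnorm_ge0// sqr_rnorm_herm.
have [->|->] : j = 0 \/ j = 1.
  by case: j => [[|[|//]] ?]; [left|right]; exact: val_inj.
by rewrite lerDl sqr_ge0.
by rewrite lerDr sqr_ge0.
Qed.

(* (l - lam) u = f, and v, w are the boundary vectors Gamma_1 + i Gamma_2 and
   Gamma_1 - i Gamma_2, so that u belongs to Dom(L_K) when K v = w. *)
Definition rel f u v w : Prop := exists y z,
  [/\ SL f (fun x => complex.Re (y x)) (fun x => complex.Im (y x))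
        (fun x => complex.Re (z x)) (fun x => complex.Im (z x)),
      ae_on a b (fun x => u x = y x),
      v = Gamma1 a b z + i *: Gamma2 a b y &
      w = Gamma1 a b z - i *: Gamma2 a b y].

Lemma Gamma1_lin k z z' : Gamma1 a b (fun x => k * z x + z' x) =
  k *: Gamma1 a b z + Gamma1 a b z'.
Proof.
by apply/colP => j; rewrite !mxE; case: ifP => _; rewrite // opprD mulrN.
Qed.

Lemma Gamma2_lin k y y' : Gamma2 a b (fun x => k * y x + y' x) =
  k *: Gamma2 a b y + Gamma2 a b y'.
Proof. by apply/colP => j; rewrite !mxE; case: ifP. Qed.

Lemma rel_lin k f u v w f' u' v' w' : rel f u v w -> rel f' u' v' w' ->
  rel (k *: f + f') (k *: u + u') (k *: v + v') (k *: w + w').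
Proof.
move=> [y [z [S uy -> ->]]] [y' [z' [S' uy' -> ->]]].
exists (fun x => k * y x + y' x), (fun x => k * z x + z' x); split.
- have := SLsys_lin (complex.Re k) (complex.Im k) S S'.
  have -> : complex.Re k +i* complex.Im k = k by case: (k).
  have E1 (c d : R -> R[i]) : (fun x => complex.Re (k * c x + d x)) =
    fun x => complex.Re k * complex.Re (c x) - complex.Im k * complex.Im (c x) +
      complex.Re (d x).
    by apply/funext => x; case: (k) (c x) (d x) => [? ?] [? ?] [? ?].
  have E2 (c d : R -> R[i]) : (fun x => complex.Im (k * c x + d x)) =
    fun x => complex.Re k * complex.Im (c x) + complex.Im k * complex.Re (c x) +
      complex.Im (d x).
    by apply/funext => x; case: (k) (c x) (d x) => [? ?] [? ?] [? ?].
  by rewrite !E1 !E2.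
- apply: ae_onS (ae_onI (ae_onI (L2_funD (k *: u) u') (L2_funZ k u)) (ae_onI uy uy')) _.
  by move=> x _ [[-> ->] [-> ->]].
- rewrite Gamma1_lin Gamma2_lin !scalerDr [i *: (k *: _)]scalerA mulrC -scalerA.
  exact: addrACA.
- rewrite Gamma1_lin Gamma2_lin !scalerDr [i *: (k *: _)]scalerA mulrC -scalerA.
  by rewrite opprD scalerN; exact: addrACA.
Qed.

(** By polarization |v|^2 - |w|^2 is -4 times the increment of Im(z conj(y)) from a to b, so this is
    [SLsys_energy] multiplied by 4. *)
Lemma rel_energy f u v w : l2 < 0 -> rel f u v w ->
  rnorm v ^+ 2 + 2 * (- l2) * rnorm u ^+ 2 <=
  rnorm w ^+ 2 + 2 / (- l2) * rnorm f ^+ 2.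
Proof.
move=> l20 [y [z [S uy -> ->]]].
have uy' : ae_on a b (fun x => u x = complex.Re (y x) +i* complex.Im (y x)).
  by apply: ae_onS uy _ => x _ ->; case: (y x).
have := SLsys_energy ab l20 S uy'.
rewrite !sqr_rnorm_L2 !sqr_rnorm_herm !mxE /= !sqr_normc.
case: (y a) (z a) (y b) (z b) => [y1 y2] [z1 z2] [y3 y4] [z3 z4] /=.
set m := - l2; set U := L2sq u; set F := L2sq f.
have m0 : m != 0 by rewrite /m oppr_eq0 lt_eqF.
have -> : (m * 2)^-1 * F = (2 / m * F) / 4 by field.
lra.
Qed.

End Rel.

(** * Steering the system and attaining boundary vectors *)

Section RelBounds.
Context (R : realType).
Variables (a b : R) (ab : a < b) (r s t : R -> R).
Hypotheses (ir : L1_on a b r) (is_ : L1_on a b s) (it : L1_on a b t).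
Hypothesis r0 : ae_on a b (fun x => r x != 0).
Variables (l1 l2 : R) (l20 : l2 < 0).
Implicit Types (f h u : L2J a b) (v w : hermC2 R).
Local Notation i := (0 +i* 1 : R[i]).
Local Notation SL := (SLsys r s t l1 l2).
Local Notation rel := (@rel R a b r s t l1 l2).

(* The controls are the solutions k of the homogeneous adjoint system: if k steers
   the zero initial state to 0 then the norm of k is 0 by SLsys_adjoint. *)
Lemma SLsys_control (c : 'cV[R]_4) : exists h (y1 y2 z1 z2 : R -> R),
  [/\ SL h y1 y2 z1 z2, vec4 (y1 a) (y2 a) (z1 a) (z2 a) = 0 &
      vec4 (y1 b) (y2 b) (z1 b) (z2 b) = c].
Proof.
(* [S d c] sends the initial state d of an adjoint solution k to the state c at b that k reaches
   from rest at a. Both are vectors of dimension 4, so it suffices that c = 0 forces d = 0. *)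
pose S (d c : 'cV[R]_4) := exists k1 k2 e1 e2 (k : L2J a b) y1 y2 z1 z2,
  [/\ SLsys r s t l1 (- l2) (0 : L2J a b) k1 k2 e1 e2 /\
        ae_on a b (fun x => k x = k1 x +i* k2 x),
      d = vec4 (k1 a) (k2 a) (e1 a) (e2 a),
      SL k y1 y2 z1 z2, vec4 (y1 a) (y2 a) (z1 a) (z2 a) = 0 &
      c = vec4 (y1 b) (y2 b) (z1 b) (z2 b)].
suff : exists d, S d c.
  move=> [d [k1 [k2 [e1 [e2 [k [y1 [y2 [z1 [z2 [_ _ h1 h2 h3]]]]]]]]]]].
  by exists k, y1, y2, z1, z2.
apply: lin_rel_surj.
- move=> x d d' c1 c2.
  move=> [k1 [k2 [e1 [e2 [k [y1 [y2 [z1 [z2 [[K kE] -> Y y0 ->]]]]]]]]]].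
  move=> [k1' [k2' [e1' [e2' [k' [y1' [y2' [z1' [z2' [[K' kE'] -> Y' y0' ->]]]]]]]]]].
  do 4 eexists; exists ((x +i* 0) *: k + k'); do 4 eexists; split.
  + split; first by have := SLsys_lin x 0 K K'; rewrite scaler0 addr0; apply.
    apply: ae_onS (ae_onI (ae_onI (L2_funD ((x +i* 0) *: k) k')
      (L2_funZ (x +i* 0) k)) (ae_onI kE kE')) _.
    by move=> X _ [[-> ->] [-> ->]]; rewrite /GRing.add /GRing.mul/=.
  + by rewrite vec4_lin; congr vec4; rewrite mul0r ?subr0 ?addr0.
  + exact: (SLsys_lin x 0 Y Y').
  + rewrite -[RHS](_ : x *: vec4 (y1 a) (y2 a) (z1 a) (z2 a) +
      vec4 (y1' a) (y2' a) (z1' a) (z2' a) = 0); last first.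
      by rewrite y0 y0' scaler0 addr0.
    by rewrite vec4_lin; congr vec4; rewrite mul0r ?subr0 ?addr0.
  + by rewrite vec4_lin; congr vec4; rewrite mul0r ?subr0 ?addr0.
- move=> d; have [d0 [d1 [d2 [d3 ->]]]] := vec4_surj d.
  have [k1 [k2 [e1 [e2 [K [ka0 ka1 ka2 ka3]]]]]] :=
    SLsys_exists ab ir is_ it l1 (- l2) (0 : L2J a b) d0 d1 d2 d3.
  have [K1 K2 _ _] := K.
  have [k kE] := L2_of_ac (ltW ab) (proj1 K1) (proj1 K2).
  have [y1 [y2 [z1 [z2 [Y [ya0 ya1 ya2 ya3]]]]]] :=
    SLsys_exists ab ir is_ it l1 l2 k 0 0 0 0.
  eexists; exists k1, k2, e1, e2, k, y1, y2, z1, z2; split => //.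
    by rewrite ka0 ka1 ka2 ka3.
  by rewrite ya0 ya1 ya2 ya3 vec4_0.
move=> d [k1 [k2 [e1 [e2 [k [y1 [y2 [z1 [z2 [[K kE] -> Y]]]]]]]]]].
rewrite -!vec4_0 => /vec4_inj[ya0 ya1 ya2 ya3] /vec4_inj[yb0 yb1 yb2 yb3].
have /= := SLsys_adjoint ab K kE Y.
rewrite ya0 ya1 ya2 ya3 -yb0 -yb1 -yb2 -yb3 !mul0r !addr0 !subr0.
rewrite -sqr_rnorm_L2 => /esym/eqP; rewrite sqrf_eq0 => /eqP/rnorm_eq0 k0.
have kE' : ae_on a b (fun x => 0 = k1 x +i* k2 x).
  by apply: ae_onS (ae_onI kE (L2_fun0 a b)) _ => x _ [<-]; rewrite k0.
by have [-> -> -> ->] := SLsys_unique0 ab r0 K kE'.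
Qed.

Lemma rel_of_solution f (y1 y2 z1 z2 : R -> R) : SL f y1 y2 z1 z2 ->
  exists u, let y x := y1 x +i* y2 x in let z x := z1 x +i* z2 x in
  rel f u (Gamma1 a b z + i *: Gamma2 a b y) (Gamma1 a b z - i *: Gamma2 a b y).
Proof.
move=> Y; have [[Y1 _] [Y2 _] _ _] := Y.
have [u uE] := L2_of_ac (ltW ab) Y1 Y2; exists u.
by exists (fun x => y1 x +i* y2 x), (fun x => z1 x +i* z2 x); split.
Qed.

Lemma rel_attain1 v w : exists f u, rel f u v w.
Proof.
(* Inverts v = Gamma_1 + i Gamma_2, w = Gamma_1 - i Gamma_2; the sign of [zb] comes from the second
   entry of Gamma_1. *)
pose ya := - i / 2 * (v 0 0 - w 0 0); pose yb := - i / 2 * (v 1 0 - w 1 0).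
pose za := (v 0 0 + w 0 0) / 2; pose zb := - ((v 1 0 + w 1 0) / 2).
have [y1 [y2 [z1 [z2 [Y [ya1 ya2 za1 za2]]]]]] := SLsys_exists ab ir is_ it l1 l2
  (0 : L2J a b) (complex.Re ya) (complex.Im ya) (complex.Re za) (complex.Im za).
(* The homogeneous solution has the right values at a; a solution steered from rest corrects its
   values at b and leaves those at a unchanged. *)
have [h [g1 [g2 [e1 [e2 [G]]]]]] := SLsys_control
  (vec4 (complex.Re yb - y1 b) (complex.Im yb - y2 b)
        (complex.Re zb - z1 b) (complex.Im zb - z2 b)).
rewrite -vec4_0 => /vec4_inj[ga1 ga2 ea1 ea2] /vec4_inj[gb1 gb2 eb1 eb2].
have YG := SLsys_lin 1 0 G Y.
have [u /= uP] := rel_of_solution YG.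
exists ((1 +i* 0) *: h + 0), u.
have i2 : i * i = -1.
  by rewrite /GRing.mul /=; apply/eqP; rewrite eq_complex /=; apply/andP; split;
    apply/eqP; ring.
set Y0 := (X in Gamma2 _ _ X) in uP; set Z0 := (X in Gamma1 _ _ X) in uP.
have [Ya Yb Za Zb] : [/\ Y0 a = ya, Y0 b = yb, Z0 a = za & Z0 b = zb].
  rewrite /Y0 /Z0 ga1 ga2 ea1 ea2 gb1 gb2 eb1 eb2 ya1 ya2 za1 za2.
  by split; [case: (ya)|case: (yb)|case: (za)|case: (zb)] => p q /=; congr (_ +i* _); ring.
have ord2 (j : 'I_2) : j = 0 \/ j = 1.
  by case: j => [[|[|//]] ?]; [left|right]; exact: val_inj.
have vE : Gamma1 a b Z0 + i *: Gamma2 a b Y0 = v.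
  apply/colP => j; rewrite !mxE Ya Yb Za Zb /ya /yb /za /zb.
  by case: (ord2 j) => -> /=; rewrite !mulrA !mulrN i2; field.
have wE : Gamma1 a b Z0 - i *: Gamma2 a b Y0 = w.
  apply/colP => j; rewrite !mxE Ya Yb Za Zb /ya /yb /za /zb.
  by case: (ord2 j) => -> /=; rewrite !mulrA !mulrN i2; field.
by rewrite vE wE in uP.
Qed.

End RelBounds.

Section RelBounds2.
Context (R : realType).
Variables (a b : R) (ab : a < b) (r s t : R -> R).
Hypotheses (ir : L1_on a b r) (is_ : L1_on a b s) (it : L1_on a b t).
Hypothesis r0 : ae_on a b (fun x => r x != 0).
Variables (l1 l2 : R) (l20 : l2 < 0).
Implicit Types (f h u : L2J a b) (v w : hermC2 R).
Local Notation i := (0 +i* 1 : R[i]).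
Local Notation SL := (SLsys r s t l1 l2).
Local Notation rel := (@rel R a b r s t l1 l2).

Lemma rel0 : rel 0 0 0 0.
Proof.
have [f [u fu]] := rel_attain1 ab ir is_ it r0 l1 l2 0 0.
by have := rel_lin (-1) fu fu; rewrite !scaleN1r !addNr.
Qed.

Lemma relD f u v w f' u' v' w' : rel f u v w -> rel f' u' v' w' ->
  rel (f + f') (u + u') (v + v') (w + w').
Proof. by move=> h h'; have := rel_lin 1 h h'; rewrite !scale1r. Qed.

Lemma relB f u v w f' u' v' w' : rel f u v w -> rel f' u' v' w' ->
  rel (f - f') (u - u') (v - v') (w - w').
Proof.
move=> h h'; have := rel_lin (-1) h' h; rewrite !scaleN1r.
by rewrite ![- _ + _]addrC.
Qed.

Lemma rnorm_sum (V : normedModType R[i]) n (g : 'I_n -> V) :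
  rnorm (\sum_j g j) <= \sum_j rnorm (g j).
Proof.
elim: (index_enum _) => [|j l IH]; first by rewrite !big_nil rnorm0.
by rewrite !big_cons (le_trans (rnormD _ _))// lerD2l.
Qed.

(** Selecting f for the four basis vectors of the space of pairs (v, w) and extending linearly gives
    one constant for all pairs. *)
Lemma rel_attain : exists2 C : R, 0 < C & forall v w, exists f u,
  rel f u v w /\ rnorm f <= C * (rnorm v + rnorm w).
Proof.
pose S (c : 'cV[R[i]]_(2 + 2)) f := exists u, rel f u (usubmx c) (dsubmx c).
have Slin k c d f h : S c f -> S d h -> S (k *: c + d) (k *: f + h).
  move=> [u uP] [u' uP']; exists (k *: u + u').
  have -> : usubmx (k *: c + d) = k *: usubmx c + usubmx d.
    by apply/matrixP => p q; rewrite !mxE.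
  have -> : dsubmx (k *: c + d) = k *: dsubmx c + dsubmx d.
    by apply/matrixP => p q; rewrite !mxE.
  exact: rel_lin.
have S0 : S 0 0 by exists 0; rewrite !linear0; exact: rel0.
have [g gP] := choice (fun j : 'I_(2 + 2) =>
  rel_attain1 ab ir is_ it r0 l1 l2 (usubmx (delta_mx j 0)) (dsubmx (delta_mx j 0))).
have SA := lin_rel_sum Slin S0 gP.
exists (\sum_j rnorm (g j) + 1) => [|v w].
  by rewrite ltr_wpDl// sumr_ge0// => j _; exact: rnorm_ge0.
have [u] := SA (col_mx v w); rewrite col_mxKu col_mxKd => uP.
exists (\sum_j col_mx v w j 0 *: g j), u; split => //.
apply: le_trans (rnorm_sum _) _.
have vw0 : 0 <= rnorm v + rnorm w by rewrite addr_ge0// rnorm_ge0.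
rewrite mulrDl mul1r ler_wpDr// mulr_suml; apply: ler_sum => j _.
rewrite rnormZ mulrC ler_wpM2l ?rnorm_ge0//.
rewrite mxE; case: splitP => k _.
  by rewrite (le_trans (normc_le_rnorm v k))// lerDl rnorm_ge0.
by rewrite (le_trans (normc_le_rnorm w k))// lerDr rnorm_ge0.
Qed.

Let cj (c : R[i]) : R[i] := complex.Re c +i* - complex.Im c.

(** With c, d the entries of Gamma_1, Gamma_2 of y and e, g those of the test solution, the
    prescribed boundary vectors force e = conj(d) and g = - conj(c). *)
Let dual_boundary (c d e g : R[i]) : cj (i * (c - i * d)) = e + i * g ->
  cj (- (i * (c + i * d))) = e - i * g -> e = cj d /\ g = - cj c.
Proof.
clear; rewrite /cj; case: c d e g => [c1 c2] [d1 d2] [e1 e2] [g1 g2] /=.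
by move=> [p1 p2] [p3 p4]; split; congr (_ +i* _); lra.
Qed.

(* Testing Lagrange's identity against a solution whose boundary values are dual to
   those of y turns it into an identity for the norm of the boundary values of y. *)
Lemma rel_lower : exists2 C : R, 0 < C & forall u v w, rel 0 u v w ->
  rnorm v ^+ 2 + rnorm w ^+ 2 <= C * rnorm u ^+ 2.
Proof.
have [C C0 CP] := rel_attain; exists (8 * C ^+ 2) => [|u v w].
  by rewrite mulr_gt0// exprn_gt0.
move=> [y [z [Y uy vE wE]]].
have ncj c : normc (cj c) = normc c.
  by case: c => p q; rewrite /cj/= sqrrN.
have ni c : normc (i * c) = normc c.
  by rewrite normcM /= expr0n expr1n add0r sqrtr1 mul1r.
have nN c : normc (- c) = normc c by case: c => p q /=; rewrite !sqrrN.
(* These data turn Re(z g - y e) into |y|^2 + |z|^2 at b and into its negative at a, so that [L] is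
   the sum of |y|^2 + |z|^2 over both ends. *)
pose v' : hermC2 R := \col_j cj (i * w j 0).
pose w' : hermC2 R := \col_j cj (- (i * v j 0)).
have nv' : rnorm v' ^+ 2 = rnorm w ^+ 2.
  by rewrite !sqr_rnorm_herm !mxE !ncj !ni.
have nw' : rnorm w' ^+ 2 = rnorm v ^+ 2.
  by rewrite !sqr_rnorm_herm !mxE !ncj !nN !ni.
have [h [u' [[g [e [G _ v'E w'E]]] hC]]] := CP v' w'.
have uy' : ae_on a b (fun x => u x = complex.Re (y x) +i* complex.Im (y x)).
  by apply: ae_onS uy _ => x _ ->; case: (y x).
(* As |h|^2 <= 2 C^2 (|v|^2 + |w|^2), the term with h is at most a quarter of |v|^2 + |w|^2, half of
   [L]. The remaining quarter is bounded by 2 C^2 |u|^2, whence the constant 8 C^2. *)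
pose eps := (4 * C ^+ 2)^-1.
have C2 : 0 < C ^+ 2 by rewrite exprn_gt0.
have eps0 : 0 < eps by rewrite invr_gt0 mulr_gt0.
have /= := SLsys_lagrange ab eps0 Y uy' G.
set L := (X in X <= _).
have LE : L = (rnorm v ^+ 2 + rnorm w ^+ 2) / 2.
  move: v'E w'E; rewrite /v' /w' vE wE => /colP v'E /colP w'E.
  have va : cj (i * (z a - i * y a)) = e a + i * g a.
    by have := v'E 0; rewrite !mxE.
  have wa : cj (- (i * (z a + i * y a))) = e a - i * g a.
    by have := w'E 0; rewrite !mxE.
  have vb : cj (i * (- z b - i * y b)) = - e b + i * g b.
    by have := v'E 1; rewrite !mxE.
  have wb : cj (- (i * (- z b + i * y b))) = - e b - i * g b.
    by have := w'E 1; rewrite !mxE.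
  have [Ea Ga] := dual_boundary va wa; have [Eb Gb] := dual_boundary vb wb.
  move: v'E w'E va wa vb wb => _ _ _ _ _ _.
  rewrite {}/L Ga Gb Ea -[e b]opprK Eb {Ga Gb Ea Eb}.
  rewrite !sqr_rnorm_herm !mxE /= !sqr_normc.
  move: (y a) (z a) (y b) (z b).
  by move=> [y1 y2] [z1 z2] [y3 y4] [z3 z4] /=; field.
rewrite LE -!sqr_rnorm_L2.
have hC2 : rnorm h ^+ 2 <= 2 * C ^+ 2 * (rnorm v ^+ 2 + rnorm w ^+ 2).
  apply: (@le_trans _ _ ((C * (rnorm v' + rnorm w')) ^+ 2)).
    by rewrite lerXn2r ?nnegrE ?rnorm_ge0// mulr_ge0 ?(ltW C0)// addr_ge0// rnorm_ge0.
  have -> : 2 * C ^+ 2 * (rnorm v ^+ 2 + rnorm w ^+ 2) =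
    C ^+ 2 * (2 * (rnorm v ^+ 2 + rnorm w ^+ 2)) by ring.
  rewrite exprMn; apply: ler_wpM2l; first exact: ltW.
  rewrite -nv' -nw'; by have := sqr_ge0 (rnorm v' - rnorm w'); lra.
have -> : (eps * 2)^-1 = 2 * C ^+ 2 by rewrite /eps; field; rewrite gt_eqF.
have hC3 : eps / 2 * rnorm h ^+ 2 <= (rnorm v ^+ 2 + rnorm w ^+ 2) / 4.
  apply: (@le_trans _ _ (eps / 2 * (2 * C ^+ 2 * (rnorm v ^+ 2 + rnorm w ^+ 2)))).
    by rewrite ler_wpM2l// divr_ge0// ltW.
  by rewrite le_eqVlt; apply/orP; left; apply/eqP; rewrite /eps; field; rewrite gt_eqF.
lra.
Qed.

Lemma rel_solve f w : exists u v, rel f u v w.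
Proof.
have [y1 [y2 [z1 [z2 [Y _]]]]] := SLsys_exists ab ir is_ it l1 l2 f 0 0 0 0.
have [u0 /= rel_f] := rel_of_solution ab Y; move: rel_f.
set v0 := (X in rel _ _ X); set w0 := (X in rel _ _ _ X) => rel_f.
suff [u1 [v1 h1]] : exists u v, rel 0 u v (w - w0).
  exists (u0 + u1), (v0 + v1); have := relD rel_f h1.
  by rewrite addr0 [w0 + _]addrC subrK.
(* The vector c is (2 i y(a), 2 z(a)), the initial state of a homogeneous solution up to factors. *)
pose S (c w : 'cV[R[i]]_2) := exists u v, rel 0 u v w /\
  c = \col_(j < 2) (if j == 0 then v 0 0 - w 0 0 else v 0 0 + w 0 0).
suff [c [u1 [v1 [h1 _]]]] : exists c, S c (w - w0) by exists u1, v1.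
apply: lin_rel_surj.
- move=> k c d c' d' [u [v [h ->]]] [u' [v' [h' ->]]].
  exists (k *: u + u'), (k *: v + v'); split.
    by have := rel_lin k h h'; rewrite scaler0 addr0.
  by apply/colP => j; rewrite !mxE; case: ifP => _; ring.
- move=> c; pose ya := - i / 2 * c 0 0; pose za := c 1 0 / 2.
  have [g1 [g2 [e1 [e2 [G [ya1 ya2 za1 za2]]]]]] := SLsys_exists ab ir is_ it l1 l2
    (0 : L2J a b) (complex.Re ya) (complex.Im ya) (complex.Re za) (complex.Im za).
  have [u /= uP] := rel_of_solution ab G.
  eexists; exists u; eexists; split; first exact: uP.
  have Ya : g1 a +i* g2 a = ya by rewrite ya1 ya2; case: (ya).
  have Za : e1 a +i* e2 a = za by rewrite za1 za2; case: (za).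
  have i2 : i * i = -1.
    by rewrite /GRing.mul /=; apply/eqP; rewrite eq_complex /=; apply/andP; split;
      apply/eqP; ring.
  apply/colP => j; rewrite !mxE /= Ya Za.
  have [->|->] : j = 0 \/ j = 1.
    by case: j => [[|[|//]] ?]; [left|right]; exact: val_inj.
    rewrite /= /ya [LHS](_ : _ = - (i * i) * c 0 0); first by field.
    by rewrite i2 opprK mul1r.
  by rewrite /= /za; field.
(* For f = 0 and w = 0 the energy inequality forces v = 0, hence a zero initial state. *)
move=> c [u [v [h ->]]]; have := rel_energy ab l20 h.
rewrite !rnorm0 expr0n /= mulr0 addr0 => en.
have u0' : 0 <= 2 * (- l2) * rnorm u ^+ 2.
  by rewrite mulr_ge0 ?sqr_ge0// mulr_ge0// oppr_ge0 ltW.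
have v0' : rnorm v ^+ 2 = 0.
  by apply/eqP; rewrite eq_le sqr_ge0 andbT; lra.
have -> : v = 0 by apply: rnorm_eq0; apply/eqP; rewrite -sqrf_eq0 v0'.
by apply/colP => j; rewrite !mxE subr0 addr0 if_same.
Qed.

End RelBounds2.

(** * Resolvents *)

Section Lipschitz.
Context (R : realType) (V W : normedModType R[i]).

Lemma lipschitz_within (A : set V) (f : V -> W) (C : R) :
  (forall x y, A x -> A y -> rnorm (f x - f y) <= C * rnorm (x - y)) ->
  {within A, continuous f}.
Proof.
move=> fC; apply/subspace_continuousP => x Ax; apply/cvgrPdist_lt => e e0.
have C1 : 0 < `|C| + 1 by rewrite ltr_wpDl.
have eE : e = (complex.Re e)%:C by rewrite ge0_ReK// ltW.
have e0' : 0 < complex.Re e.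
  by move: e0; rewrite {1}eE ltcE /= eqxx.
rewrite near_withinE; near=> y => Ay.
rewrite rnormE eE ltcE /= eqxx /=.
apply: (@le_lt_trans _ _ ((`|C| + 1) * rnorm (x - y))).
  apply: le_trans (fC _ _ Ax Ay) _; rewrite ler_wpM2r ?rnorm_ge0//.
  by rewrite (le_trans (ler_norm C))// lerDl.
rewrite -ltr_pdivlMl//.
have : `|x - y| < ((`|C| + 1)^-1 * complex.Re e)%:C.
  near: y; apply: (@cvgr_dist_lt _ _ _ _ _ id); first exact: cvg_id.
  by rewrite ltcE /= eqxx /= mulr_gt0// invr_gt0.
by rewrite rnormE ltcE /= eqxx.
Unshelve. all: by end_near. Qed.

End Lipschitz.

Section BiLipschitz.
Context (R : realType) (V W : normedModType R[i]).

Lemma bilipschitz_homeo (A : set V) (f : V -> W) (C D : R) :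
  (forall x y, A x -> A y -> rnorm (f x - f y) <= C * rnorm (x - y)) ->
  (forall x y, A x -> A y -> rnorm (x - y) <= D * rnorm (f x - f y)) ->
  homeo_onto_image A f.
Proof.
move=> fC fD; split; first exact: lipschitz_within fC.
pose g y := xget 0 [set x | A x /\ f x = y].
have gK x : A x -> g (f x) = x.
  move=> Ax; have [Ag fg] : [set x' | A x' /\ f x' = f x] (g (f x)).
    by apply: (@xgetPex _ 0); exists x.
  apply/eqP; rewrite -subr_eq0; apply/eqP/rnorm_eq0/eqP.
  rewrite eq_le rnorm_ge0 andbT; have := fD _ _ Ag Ax.
  by rewrite fg subrr rnorm0 mulr0.
exists g; split; first by move=> x; rewrite inE; exact: gK.
apply: (@lipschitz_within _ _ _ _ _ D) => _ _ [x Ax <-] [y Ay <-].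
by rewrite !gK //; exact: fD.
Qed.

End BiLipschitz.

(** * Resolvents of an abstract boundary relation *)

Section AbstractResolvent.
Context (R : realType) (V : normedModType R[i]).
Local Notation H := (hermC2 R).
Variable rel : V -> V -> H -> H -> Prop.
Implicit Types (f u : V) (v w : H) (K : bounded_op H H) (T : bounded_op V V).
Hypothesis rel_lin : forall k f u v w f' u' v' w', rel f u v w ->
  rel f' u' v' w' -> rel (k *: f + f') (k *: u + u') (k *: v + v') (k *: w + w').
Variables (m C B : R) (m0 : 0 < m) (C0 : 0 <= C) (B0 : 0 <= B).
Hypothesis rel_energy : forall f u v w, rel f u v w ->
  rnorm v ^+ 2 + 2 * m * rnorm u ^+ 2 <= rnorm w ^+ 2 + 2 / m * rnorm f ^+ 2.
Hypothesis rel_attain : forall v w, exists f u,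
  rel f u v w /\ rnorm f <= C * (rnorm v + rnorm w).
Hypothesis rel_lower : forall u v w, rel 0 u v w ->
  rnorm v <= B * rnorm u /\ rnorm w <= B * rnorm u.
Hypothesis rel_solve : forall f w, exists u v, rel f u v w.

Let relD f u v w f' u' v' w' : rel f u v w -> rel f' u' v' w' ->
  rel (f + f') (u + u') (v + v') (w + w').
Proof. by move=> h h'; have := rel_lin 1 h h'; rewrite !scale1r. Qed.

Let relB f u v w f' u' v' w' : rel f u v w -> rel f' u' v' w' ->
  rel (f - f') (u - u') (v - v') (w - w').
Proof.
move=> h h'; have := rel_lin (-1) h' h; rewrite !scaleN1r.
by rewrite ![- _ + _]addrC.
Qed.

Let opD (V' W' : normedModType R[i]) (S : bounded_op V' W') x y :
  S (x + y) = S x + S y.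
Proof. exact: linearD. Qed.

Let opZ (V' W' : normedModType R[i]) (S : bounded_op V' W') k x :
  S (k *: x) = k *: S x.
Proof. exact: linearZ. Qed.

Let opB (V' W' : normedModType R[i]) (S : bounded_op V' W') x y :
  S (x - y) = S x - S y.
Proof. exact: linearB. Qed.

Lemma rnorm_op (V' W' : normedModType R[i]) (S : bounded_op V' W') x :
  rnorm (S x) <= rnorm S * rnorm x.
Proof.
have : `|S x| <= `|S| * `|x| := le_op_norm S x.
by move=> /le_Re; rewrite !rnormE /= mul0r subr0.
Qed.

Lemma rnorm_op_le (V' W' : normedModType R[i]) (S : bounded_op V' W') (M : R) :
  0 <= M -> (forall x, rnorm (S x) <= M * rnorm x) -> rnorm S <= M.
Proof.
move=> M0 SM; have : op_norm S <= M%:C.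
  apply: op_norm_le => x x1; rewrite rnormE le_realC (le_trans (SM x))//.
  by rewrite -[leRHS]mulr1 ler_wpM2l//; have := le_Re x1.
by move=> /le_Re.
Qed.

Lemma rnorm_contracting K v : contracting K -> rnorm (K v) <= rnorm v.
Proof.
move=> /le_Re K1; apply: le_trans (rnorm_op K v) _.
by rewrite -[leRHS]mul1r ler_wpM2r// rnorm_ge0.
Qed.

Let bound_u f u v w : rel f u v w -> rnorm w <= rnorm v ->
  rnorm u <= m^-1 * rnorm f.
Proof.
move=> /rel_energy en wv.
rewrite ler_pdivlMl// -(@ler_pXn2r _ 2) ?nnegrE ?mulr_ge0 ?rnorm_ge0 ?(ltW m0)//.
have {wv}wv : rnorm w ^+ 2 <= rnorm v ^+ 2 by rewrite lerXn2r ?nnegrE ?rnorm_ge0.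
have {en wv}en : 2 * m * rnorm u ^+ 2 <= 2 / m * rnorm f ^+ 2 by lra.
have -> : (m * rnorm u) ^+ 2 = m / 2 * (2 * m * rnorm u ^+ 2) by field.
have -> : rnorm f ^+ 2 = m / 2 * (2 / m * rnorm f ^+ 2).
  by field; rewrite gt_eqF.
by apply: ler_wpM2l => //; rewrite divr_ge0// ltW.
Qed.

Lemma rel_contraction_solve K f : contracting K -> exists u v, rel f u v (K v).
Proof.
move=> K1; have [u0 [v0 h0]] := rel_solve f 0.
(* Starting from the solution with w = 0, a homogeneous correction with boundary vectors (v1, c) is
   needed such that c = K (v0 + v1), that is, c - K v1 = K v0. *)
pose S (c d : 'cV[R[i]]_2) := exists u v, rel 0 u v c /\ d = (c : H) - K v.
suff [c [u1 [v1 [h1 dE]]]] : exists c, S c (K v0).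
  exists (u0 + u1), (v0 + v1); have := relD h0 h1.
  by rewrite addr0 add0r opD dE subrK.
apply: lin_rel_surj.
- move=> k c d c' d' [u [v [h ->]]] [u' [v' [h' ->]]].
  exists (k *: u + u'), (k *: v + v'); split.
    by have := rel_lin k h h'; rewrite scaler0 addr0.
  by rewrite opD opZ scalerBr opprD addrACA.
- by move=> c; have [u [v h]] := rel_solve 0 c; exists (c - K v), u, v.
move=> c [u [v [h /esym/eqP]]]; rewrite subr_eq0 => /eqP cE.
have := bound_u h; rewrite rnorm0 mulr0 {1}cE => /(_ (rnorm_contracting _ K1)) u0'.
apply: (@rnorm_eq0 _ H); apply/eqP; rewrite eq_le rnorm_ge0 andbT.
have [_ cB] := rel_lower h; apply: le_trans cB _.
by rewrite mulr_ge0_le0.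
Qed.

Lemma rel_contraction_unique K f u v u' v' : contracting K ->
  rel f u v (K v) -> rel f u' v' (K v') -> u = u'.
Proof.
move=> K1 h h'; have := relB h h'; rewrite subrr -opB.
move=> /bound_u /(_ (rnorm_contracting _ K1)); rewrite rnorm0 mulr0 => u0.
apply/eqP; rewrite -subr_eq0; apply/eqP/rnorm_eq0/eqP.
by rewrite eq_le u0 rnorm_ge0.
Qed.

Definition solves K T : Prop := forall f, exists v, rel f (T f) v (K v).

(** The solution operator is linear by uniqueness and Lipschitz by [bound_u]. *)
Lemma solves_exists K : contracting K -> exists T, solves K T.
Proof.
move=> K1; have [T TP] := choice (fun f => rel_contraction_solve f K1).
have Tlin : linear T.
  move=> k f g; have [v h] := TP f; have [v' h'] := TP g.
  have [w hw] := TP (k *: f + g); apply: (rel_contraction_unique K1 hw (v' := k *: v + v')).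
  by rewrite opD opZ; exact: rel_lin.
have Tlip x y : rnorm (T x - T y) <= m^-1 * rnorm (x - y).
  have [v h] := TP x; have [v' h'] := TP y; have := relB h h'.
  by rewrite -opB => /bound_u; apply; exact: rnorm_contracting.
have Tc : continuous T.
  apply/continuous_subspace_setT.
  by apply: (lipschitz_within (C := m^-1)) => x y _ _; exact: Tlip.
have Top : T \in @bounded_op_pred R V V by rewrite inE; split.
by exists (BoundedOp Top).
Qed.

(** The difference of the two solutions is homogeneous, with boundary vectors dv and K dv + ev,
    where ev = (K - K') v'. Its energy inequality bounds it by |ev|, and |v'| <= D |f|. *)
Lemma solves_lipschitz K K' T T' : contracting K -> contracting K' ->
  solves K T -> solves K' T' ->
  rnorm (T - T') <= 2 * B / m * (Num.sqrt (2 / m) + 2 * B / m) * rnorm (K - K').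
Proof.
move=> K1 K1' TP TP'; set D := Num.sqrt (2 / m) + 2 * B / m.
have D0 : 0 <= D by rewrite addr_ge0 ?sqrtr_ge0// divr_ge0 ?mulr_ge0// ltW.
have BD0 : 0 <= 2 * B / m by rewrite divr_ge0 ?mulr_ge0// ltW.
have kap0 := rnorm_ge0 (K - K').
apply: rnorm_op_le => [|f]; first by rewrite mulr_ge0// mulr_ge0.
have [v h] := TP f; have [v' h'] := TP' f.
(* [v'] is compared with the solution for w = 0: the energy inequality gives Num.sqrt (2 / m) for
   that one, and the difference, being homogeneous, adds 2 B / m. *)
have v'D : rnorm v' <= D * rnorm f.
  have [u0 [v0 h0]] := rel_solve f 0.
  have u0f : rnorm u0 <= m^-1 * rnorm f.
    by apply: bound_u h0 _; rewrite rnorm0 rnorm_ge0.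
  have u'f : rnorm (T' f) <= m^-1 * rnorm f.
    by apply: bound_u h' _; exact: rnorm_contracting.
  have v0f : rnorm v0 <= Num.sqrt (2 / m) * rnorm f.
    rewrite -(@ler_pXn2r _ 2) ?nnegrE ?mulr_ge0 ?rnorm_ge0 ?sqrtr_ge0//.
    rewrite exprMn (@sqr_sqrtr _ (2 / m)) ?divr_ge0 ?(ltW m0)//.
    have := rel_energy h0; rewrite rnorm0 expr0n /= add0r.
    move=> en0; apply: (le_trans _ en0); rewrite lerDl.
    by rewrite mulr_ge0 ?sqr_ge0// mulr_ge0// ltW.
  have := relB h' h0; rewrite subrr => /rel_lower[dv _].
  rewrite -[v'](subrK v0) addrC; apply: le_trans (rnormD _ _) _.
  rewrite mulrDl lerD// (le_trans dv)//.
  apply: (@le_trans _ _ (B * (m^-1 * rnorm f + m^-1 * rnorm f))).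
    rewrite ler_wpM2l// (le_trans (rnormD _ _))// rnormN lerD//.
  by rewrite le_eqVlt; apply/orP; left; apply/eqP; ring.
have := relB h h'; rewrite subrr.
have -> : K v - K' v' = K (v - v') + (K - K') v'.
  by rewrite opB -[(K - K') v']/(K v' - K' v') addrA subrK.
set dv := v - v'; set ev := (K - K') v'; set du := T f - T' f => hd.
have [dvB dwB] := rel_lower hd; have := rel_energy hd.
rewrite rnorm0 expr0n /= mulr0 addr0 => en.
have evk : rnorm ev <= rnorm (K - K') * (D * rnorm f).
  by apply: le_trans (rnorm_op _ _) _; rewrite ler_wpM2l.
have Kdv := rnorm_contracting dv K1.
have du0 := rnorm_ge0 du; have ev0 := rnorm_ge0 ev; have dv0 := rnorm_ge0 dv.
have evB : rnorm ev <= 2 * B * rnorm du.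
  rewrite -[ev](addKr (K dv)) (le_trans (rnormD _ _))// rnormN; lra.
have en2 : rnorm (K dv + ev) ^+ 2 <= (rnorm dv + rnorm ev) ^+ 2.
  rewrite lerXn2r ?nnegrE ?rnorm_ge0 ?addr_ge0//.
  by rewrite (le_trans (rnormD _ _))// lerD2r.
(* After |dv|^2 cancels, 2 |dv| |ev| + |ev|^2 remains. Both |dv| and |ev| are bounded by |du|, so a
   factor |du| can be divided out and the bound is linear in |ev|. *)
have key : m * rnorm du ^+ 2 <= 2 * B * rnorm ev * rnorm du.
  have p1 : rnorm dv * rnorm ev <= B * rnorm du * rnorm ev by rewrite ler_wpM2r.
  have p2 : rnorm ev * rnorm ev <= 2 * B * rnorm du * rnorm ev by rewrite ler_wpM2r.
  lra.
have duE : rnorm du <= 2 * B / m * rnorm ev.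
  have [->|dun] := eqVneq (rnorm du) 0; first by rewrite mulr_ge0.
  have dup : 0 < rnorm du by rewrite lt_neqAle eq_sym dun.
  rewrite mulrAC ler_pdivlMr// mulrC -(ler_pM2r dup) -mulrA -expr2; exact: key.
apply: (le_trans duE); rewrite [leRHS](_ : _ =
  2 * B / m * (rnorm (K - K') * (D * rnorm f))); last by ring.
exact: ler_wpM2l.
Qed.

(** Given v, take f with boundary vectors (v, K v). Then (K - K') v = (K v - K' v') - K' (v - v'),
    and each term is at most B |T f - T' f|. Since |f| <= 2 C |v|, the constant is 2 B times 2 C. *)
Lemma solves_lipschitz_inv K K' T T' : contracting K -> contracting K' ->
  solves K T -> solves K' T' ->
  rnorm (K - K') <= 4 * B * C * rnorm (T - T').
Proof.
move=> K1 K1' TP TP'; have tau0 := rnorm_ge0 (T - T').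
apply: rnorm_op_le => [|v]; first by rewrite mulr_ge0// !mulr_ge0.
have [f [u [h fC]]] := rel_attain v (K v).
have [v0 h0] := TP f; have [v' h'] := TP' f.
have uE := rel_contraction_unique K1 h h0.
have := relB h h'; rewrite subrr => /rel_lower[dv dw].
have -> : (K - K') v = (K v - K' v') - K' (v - v').
  by rewrite opB -[(K - K') v]/(K v - K' v) opprB addrA subrK.
have du : rnorm (u - T' f) <= rnorm (T - T') * rnorm f.
  by rewrite uE; exact: rnorm_op (T - T') f.
have fv : rnorm f <= C * (2 * rnorm v).
  apply: le_trans fC _; rewrite ler_wpM2l//.
  by have := rnorm_contracting v K1; lra.
apply: le_trans (rnormD _ _) _; rewrite rnormN.
apply: (@le_trans _ _ (B * rnorm (u - T' f) + B * rnorm (u - T' f))).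
  by rewrite lerD// (le_trans (rnorm_contracting _ K1')).
have du' : rnorm (u - T' f) <= rnorm (T - T') * (C * (2 * rnorm v)).
  by apply: le_trans du _; exact: ler_wpM2l.
have := ler_wpM2l B0 du'.
rewrite [leRHS](_ : _ = 4 * B * C * rnorm (T - T') * rnorm v / 2); last by field.
lra.
Qed.

End AbstractResolvent.

(** * From the operators L_K to the boundary relation *)

Section BoundaryOperator.
Context (R : realType).
Variables (a b : R) (ab : a < b) (p Q r s t : R -> R).
Hypothesis p0 : ae_on a b (fun x => p x != 0).
Hypothesis rE : ae_on a b (fun x => 1 / p x = r x).
Hypothesis sE : ae_on a b (fun x => Q x / p x = s x).
Hypothesis tE : ae_on a b (fun x => Q x ^+ 2 / p x = t x).
Variable lam : R[i].
Implicit Types (u v : L2J a b) (w : hermC2 R) (y z : R -> R[i]).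
Implicit Types (K : bounded_op (hermC2 R) (hermC2 R)).
Local Notation i := (0 +i* 1 : R[i]).
Local Notation SL := (SLsys r s t (complex.Re lam) (complex.Im lam)).
Local Notation rel := (@rel R a b r s t (complex.Re lam) (complex.Im lam)).

Let fE u v : ae_on a b (fun x => cL2_fun (v - lam *: u) x = v x - lam * u x).
Proof.
rewrite -scaleNr addrC.
apply: ae_onS (ae_onI (L2_funD (- lam *: u) v) (L2_funZ (- lam) u)) _.
by move=> x _ [-> ->]; rewrite mulNr addrC.
Qed.

Let is_derive_derivable (f : R -> R) x : derivable f x 1 ->
  is_derive x (1 : R) f (derive1 f x).
Proof. by move=> df; split=> //; rewrite derive1E. Qed.

Lemma Lmax_data_SLsys u v y z : Lmax_data p Q y z u v ->
  SL (v - lam *: u) (fun x => complex.Re (y x)) (fun x => complex.Im (y x))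
    (fun x => complex.Re (z x)) (fun x => complex.Im (z x)).
Proof.
move=> [/abs_contP[y1a y2a] /abs_contP[z1a z2a] yz uy zv].
have ae1 := ae_onI (ae_onI p0 rE) (ae_onI (ae_onI sE tE) yz).
have ae2 := ae_onI ae1 (ae_onI (ae_onI uy zv) (fE u v)).
split; split=> //; [apply: ae_onS ae1 _|apply: ae_onS ae1 _|
  apply: ae_onS ae2 _|apply: ae_onS ae2 _] => x _.
- move=> [[px rx] [[sx tx] [[d1 d2] zx]]]; have := is_derive_derivable d1.
  congr is_derive; rewrite -rx -sx zx /qderiv1 /cderiv.
  by case: (y x) => y1 y2 /=; field.
- move=> [[px rx] [[sx tx] [[d1 d2] zx]]]; have := is_derive_derivable d2.
  congr is_derive; rewrite -rx -sx zx /qderiv1 /cderiv.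
  by case: (y x) => y1 y2 /=; field.
- move=> [[[px rx] [[sx tx] _]] [[ux [[d1 d2] vx]] fx]].
  have := is_derive_derivable d1.
  congr is_derive; rewrite -sx -tx fx vx ux /qderiv2 /cderiv.
  by case: (y x) (z x) (lam) => y1 y2 [z1 z2] [m1 m2] /=; field.
- move=> [[[px rx] [[sx tx] _]] [[ux [[d1 d2] vx]] fx]].
  have := is_derive_derivable d2.
  congr is_derive; rewrite -sx -tx fx vx ux /qderiv2 /cderiv.
  by case: (y x) (z x) (lam) => y1 y2 [z1 z2] [m1 m2] /=; field.
Qed.

Lemma SLsys_Lmax_data u v y z : ae_on a b (fun x => u x = y x) ->
  SL (v - lam *: u) (fun x => complex.Re (y x)) (fun x => complex.Im (y x))
    (fun x => complex.Re (z x)) (fun x => complex.Im (z x)) ->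
  Lmax_data p Q y z u v.
Proof.
move=> uy [[y1a Y1] [y2a Y2] [z1a Z1] [z2a Z2]].
have ae1 := ae_onI (ae_onI p0 rE) (ae_onI (ae_onI sE tE) uy).
split; [by apply/abs_contP|by apply/abs_contP| |by []|].
- apply: ae_onS (ae_onI ae1 (ae_onI Y1 Y2)) _ => x _.
  move=> [[[px rx] [[sx tx] ux]] [d1 d2]].
  have [h1 e1] := d1; have [h2 e2] := d2; split; first by split.
  rewrite /qderiv1 /cderiv !derive1E e1 e2 -rx -sx.
  case: (y x) (z x) => y1 y2 [z1 z2] /=.
  by apply/eqP; rewrite eq_complex /=; apply/andP; split; apply/eqP; field.
- apply: ae_onS (ae_onI ae1 (ae_onI (ae_onI Z1 Z2) (fE u v))) _ => x _.
  move=> [[[px rx] [[sx tx] ux]] [[d1 d2] fx]].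
  have [h1 e1] := d1; have [h2 e2] := d2; split; first by split.
  rewrite /qderiv2 /cderiv !derive1E e1 e2 fx ux -tx -sx.
  case: (cL2_fun v x) (y x) (z x) (lam) => v1 v2 [y1 y2] [z1 z2] [m1 m2] /=.
  by apply/eqP; rewrite eq_complex /=; apply/andP; split; apply/eqP; field.
Qed.

Lemma LK_rel K u v : LK p Q a b K u v <->
  exists w, rel (v - lam *: u) u w (K w).
Proof.
have Kw (G1 G2 : hermC2 R) :
    K G1 - G1 + i *: (K G2 + G2) = K (G1 + i *: G2) - (G1 - i *: G2).
  have -> : K (G1 + i *: G2) = K G1 + i *: K G2.
    by rewrite linearD linearZ.
  by rewrite scalerDr opprB addrACA [- G1 + _]addrC.
split=> [[y [z [L]]]|[w [y [z [S uy wE KwE]]]]].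
  rewrite Kw => /eqP; rewrite subr_eq0 => /eqP Kw0.
  exists (Gamma1 a b z + i *: Gamma2 a b y), y, z; split => //.
    exact: Lmax_data_SLsys.
  by have [] := L.
exists y, z; split; first exact: SLsys_Lmax_data.
by rewrite Kw -wE KwE subrr.
Qed.

Lemma is_resolvent_solves K (T : bounded_op (L2J a b) (L2J a b)) :
  is_resolvent (LK p Q a b K) lam T -> solves rel K T.
Proof.
move=> TP f; have [/(_ erefl)[v /LK_rel[w h] vf] _] := TP f (T f).
by rewrite vf in h; exists w.
Qed.

End BoundaryOperator.

Theorem mainTheorem6 (R : realType) (a b : R) (hab : a < b) (p Q : R -> R)
  (mp : lebesgue_measurable_fun `]a, b[ p)
  (mQ : lebesgue_measurable_fun `]a, b[ Q)
  (p_neq0 : ae_on a b (fun x => p x != 0))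
  (hp : lebesgue_L1 `]a, b[ (fun x => 1 / p x))
  (hQp : lebesgue_L1 `]a, b[ (fun x => Q x / p x))
  (hQ2p : lebesgue_L1 `]a, b[ (fun x => Q x ^+ 2 / p x))
  (lam : R[i]) (hlam : complex.Im lam < 0) :
  (forall K : bounded_op (hermC2 R) (hermC2 R),
     contracting K -> resolvent_set (LK p Q a b K) lam) /\
  homeo_onto_image [set K | contracting K]
    (fun K => resolvent (LK p Q a b K) lam).
Proof.
have [r [ir rE]] := lebesgue_L1_Borel hp.
have [s [is_ sE]] := lebesgue_L1_Borel hQp.
have [t [it tE]] := lebesgue_L1_Borel hQ2p.
have r0 : ae_on a b (fun x => r x != 0).
  apply: ae_onS (ae_onI p_neq0 rE) _ => x _ [px <-].
  by rewrite mul1r invr_eq0.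
set rel := @rel R a b r s t (complex.Re lam) (complex.Im lam).
have lin : forall k f u v w f' u' v' w', rel f u v w -> rel f' u' v' w' ->
    rel (k *: f + f') (k *: u + u') (k *: v + v') (k *: w + w').
  by move=> *; exact: rel_lin.
have energy f u v w (h : rel f u v w) := rel_energy hab hlam h.
have m0 : 0 < - complex.Im lam by rewrite oppr_gt0.
have [C C0 attain] := rel_attain hab ir is_ it r0 (complex.Re lam) (complex.Im lam).
have [B B0 lower] := rel_lower hab ir is_ it r0 (complex.Re lam) (complex.Im lam).
have solve := rel_solve hab ir is_ it (complex.Re lam) hlam.
(* [lower] bounds the sum of the squares; square roots give the two linear bounds. *)
have lower' u v w : rel 0 u v w -> rnorm v <= Num.sqrt B * rnorm u /\
    rnorm w <= Num.sqrt B * rnorm u.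
  move=> /lower h; have v0 := sqr_ge0 (rnorm v); have w0 := sqr_ge0 (rnorm w).
  have le x : 0 <= x -> x ^+ 2 <= B * rnorm u ^+ 2 -> x <= Num.sqrt B * rnorm u.
    move=> x0 xB; rewrite -(@ler_pXn2r _ 2) ?nnegrE ?mulr_ge0 ?rnorm_ge0 ?sqrtr_ge0//.
    by rewrite exprMn (@sqr_sqrtr _ B) ?(ltW B0).
  by split; apply: le; rewrite ?rnorm_ge0//; lra.
have LKrel := LK_rel p_neq0 rE sE tE lam.
have res K : contracting K -> resolvent_set (LK p Q a b K) lam.
  move=> K1; have [T TP] := solves_exists lin m0 (sqrtr_ge0 B) energy lower' solve K1.
  exists T => f u; split.
    move=> Tu; have [w h] := TP f; exists (f + lam *: u); last by rewrite addrK.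
    by apply/LKrel; exists w; rewrite addrK -Tu.
  move=> [v /LKrel[w h] vf]; have [w' h'] := TP f; rewrite vf in h.
  exact: (rel_contraction_unique lin m0 energy K1 h' h).
(* By [res] a resolvent exists, so the choice in [resolvent] is not its default value 0. *)
have resP K : contracting K ->
    solves rel K (resolvent (LK p Q a b K) lam).
  move=> K1; apply: (is_resolvent_solves p_neq0 rE sE tE).
  exact: (xgetPex 0 (res K K1)).
split=> //; apply: bilipschitz_homeo => K K' K1 K1'.
  exact: (solves_lipschitz lin m0 (sqrtr_ge0 B) energy lower' solve K1 K1'
    (resP _ K1) (resP _ K1')).
exact: (solves_lipschitz_inv lin m0 (ltW C0) (sqrtr_ge0 B) energy attain lower'
  K1 K1' (resP _ K1) (resP _ K1')).
Qed.
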